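(* Let $\mathcal{P}=\{\Pr(G): G\text{ a finite group}\}\subset(0,1]$ be the set of commuting probabilities of all finite groups. The order type of $(\mathcal{P},>)$ is either $\omega^\omega$ or $\omega^{\omega^2}$.
   Context: For a finite group $G$, the commuting probability is $\Pr(G)=\frac{1}{|G|^2}|\{(x,y)\in G^2: xy=yx\}|$. The order on $\mathcal{P}$ is the reverse of the usual order of the reals (larger numbers come first); $(\mathcal{P},>)$ is a well-ordered set, and its order type is the unique ordinal order-isomorphic to it. Powers of $\omega$ are ordinal powers. *)

(* Defs.v *)
From HB Require Import structures.
From mathcomp Require Import all_boot all_order all_algebra all_fingroup.
From mathcomp Require Import finmap boolp classical_sets functions wochoice.

Set Implicit Arguments.
Unset Strict Implicit.
Unset Printing Implicit Defensive.

Import Order.TTheory GRing.Theory Num.Theory.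

(* Ordinals are represented by well-ordered types, and equality of ordinals by
   order isomorphism. [well_order] (every nonempty subset has a unique minimum)
   implies that the relation is a total order. *)
Record woType := WoType {
  wo_sort :> choiceType;
  wo_le : rel wo_sort;
  wo_leP : well_order wo_le
}.

Definition wo_lt (A : woType) : rel A := fun x y => (x != y) && wo_le x y.

Definition has_order_type (T : Type) (D : set T) (R : rel T) (A : woType) :=
  exists f : T -> A, set_bij D [set: A] f
    /\ {in D &, forall x y, wo_le (f x) (f y) = R x y}.

Lemma well_order_inj_nat (T : Type) (f : T -> nat) :
  injective f -> well_order (fun x y => f x <= f y).
Proof.
move=> f_inj; apply: antisymmetric_well_order => [x y /anti_leq/f_inj //|A].
move=> [x Ax].
have exA : exists n, `[< exists2 y, y \in A & f y = n >].
  by exists (f x); apply/asboolP; exists x.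
have [n /asboolP[y Ay <-] min_y] := ex_minnP exA.
exists y; split=> // z Az; apply: min_y.
by apply/asboolP; exists z.
Qed.

Definition wo_omega : woType := WoType (well_order_inj_nat (@inj_id nat)).

Definition wo_fin (n : nat) : woType :=
  WoType (well_order_inj_nat (@ord_inj n)).

Section OmegaPower.
Variable B : woType.

(* Synthetic definition of the ordinal power omega ^ B: the finitely supported
   functions from B to omega, compared at the largest argument where they
   differ. The function f stands for the finite sum of the omega ^ b * f b,
   taken over decreasing b. *)
Definition omega_pow_lt (f g : {fsfun B -> nat with 0}) : Prop :=
  exists b : B, f b < g b /\ forall c : B, wo_lt b c -> f c = g c.

Definition omega_pow_le : rel {fsfun B -> nat with 0} :=
  fun f g => `[< f = g \/ omega_pow_lt f g >].

Let le_total : total (@wo_le B).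
Proof.
by move=> x y; apply: (@wo_chainW _ _ predT) => // A _; apply: wo_leP.
Qed.

Let le_anti : antisymmetric (@wo_le B).
Proof.
move=> x y; apply: (@wo_chain_antisymmetric _ _ predT) => // A _.
exact: wo_leP.
Qed.

Let seq_min (s : seq B) : s != [::] ->
  exists2 x, x \in s & forall y, y \in s -> wo_le x y.
Proof.
case: s => // a s _; have [|x [[xs x_min] _]] := wo_leP (A := mem (a :: s)).
  by exists a; apply: mem_head.
by exists x => // y; apply: x_min.
Qed.

Let le_trans : transitive (@wo_le B).
Proof.
move=> y x z xy yz; have [//|w ws w_min] := @seq_min [:: x; y; z].
move: ws; rewrite !inE => /or3P[]/eqP ew; rewrite {}ew in w_min.
- by apply: w_min; rewrite !inE eqxx !orbT.
- have yx : wo_le y x by apply: w_min; rewrite mem_head.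
  by rewrite (le_anti (introT andP (conj xy yx))).
- have zy : wo_le z y by apply: w_min; rewrite !inE eqxx orbT.
  by rewrite -(le_anti (introT andP (conj yz zy))).
Qed.

Let leNlt (x y : B) : wo_lt x y = ~~ wo_le y x.
Proof.
rewrite /wo_lt; case: eqVneq => [->|/eqP xy] /=.
  by have := le_total y y; rewrite orbb => ->.
case yx : (wo_le y x); last by have := le_total x y; rewrite yx orbF.
by apply/negP => xy'; apply/xy/le_anti; rewrite xy' yx.
Qed.

Let seq_max (s : seq B) : s != [::] ->
  exists2 x, x \in s & forall y, y \in s -> wo_le y x.
Proof.
elim: s => // a [|b s] IH _.
  exists a => [|y]; first exact: mem_head.
  by rewrite inE => /eqP->; have := le_total a a; rewrite orbb.
have [//|x xs x_max] := IH.
have [ax|xa] := orP (le_total a x).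
  exists x; first by rewrite inE xs orbT.
  by move=> y; rewrite inE => /predU1P[->|/x_max].
exists a; first exact: mem_head.
move=> y; rewrite inE => /predU1P[->|/x_max yx].
  by have := le_total a a; rewrite orbb.
exact: le_trans xa.
Qed.

Let trichotomy f g : [\/ f = g, omega_pow_lt f g | omega_pow_lt g f].
Proof.
pose D := [seq x <- finsupp f ++ finsupp g | f x != g x].
have inD c : f c != g c -> c \in D.
  move=> fg; rewrite mem_filter fg mem_cat !mem_finsupp.
  by move: fg; case: (f c) => // ; rewrite eq_sym => ->.
have [D0|/seq_max[b bD b_max]] := eqVneq D [::].
  constructor 1; apply/fsfunP => c; apply/eqP/negPn/negP => /inD.
  by rewrite D0.
have agree c : wo_lt b c -> f c = g c.
  move=> bc; apply/eqP/negPn/negP => /inD/b_max.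
  by apply/negP; rewrite -leNlt.
move: bD; rewrite mem_filter neq_ltn => /andP[/orP[] fg _].
  by constructor 2; exists b.
by constructor 3; exists b; split=> // c /agree.
Qed.

Let lt_irr f g : omega_pow_lt f g -> omega_pow_lt g f -> False.
Proof.
move=> [b [fgb fg]] [c [gfc gf]].
have [bc|] := boolP (wo_lt b c); first by rewrite fg // ltnn in gfc.
rewrite leNlt negbK => cb.
have [ebc|nbc] := eqVneq c b.
  by rewrite ebc in gfc; have := ltn_trans fgb gfc; rewrite ltnn.
by rewrite gf ?ltnn // /wo_lt nbc in fgb.
Qed.

Let lt_trans g f h : omega_pow_lt f g -> omega_pow_lt g h -> omega_pow_lt f h.
Proof.
move=> [b [fgb fg]] [c [ghc gh]].
have ltW (x y : B) : wo_lt x y -> wo_le x y by case/andP.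
have lt_le (x y z : B) : wo_le x y -> wo_lt y z -> wo_lt x z.
  by move=> xy; rewrite !leNlt; apply: contraNN => zx; apply: le_trans zx xy.
have [bc|] := boolP (wo_lt b c).
  exists c; split; first by rewrite fg.
  by move=> d cd; rewrite fg ?gh //; apply: lt_le cd; apply: ltW.
rewrite leNlt negbK => cb; exists b; split.
  have [ecb|ncb] := eqVneq c b; last by rewrite -gh // /wo_lt ncb.
  by rewrite ecb in ghc; apply: ltn_trans ghc.
by move=> d bd; rewrite fg // gh //; apply: lt_le bd.
Qed.

Let pow_le_trans : transitive omega_pow_le.
Proof.
move=> g f h /asboolP[->//|fg] /asboolP[<-|gh]; apply/asboolP; right=> //.
exact: lt_trans gh.
Qed.

Let has_min (S : {pred {fsfun B -> nat with 0}}) :=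
  exists z, minimum_of omega_pow_le S z.

Let agree (U : pred B) (S : {pred {fsfun B -> nat with 0}}) :=
  
  {in S &, forall f g : {fsfun B -> nat with 0},
             forall c : B, U c -> f c = g c}.

Let min_step (U : pred B) :
  (forall b, ~~ U b ->
     forall S, nonempty S -> agree (wo_lt b) S -> has_min S) ->
  forall S, nonempty S -> agree U S -> has_min S.
Proof.
move=> IH S [g gS] SU.
have top k : k \in S -> omega_pow_lt k g ->
    exists b, [/\ ~~ U b, k b < g b & forall c, wo_lt b c -> k c = g c].
  move=> kS [b [kgb kg]]; exists b; split=> //; apply/negP => Ub.
  by move: kgb; rewrite (SU k g) ?ltnn.
pose W := [seq x <- finsupp g | ~~ U x].
have [W0|/seq_max[b bW b_max]] := eqVneq W [::].
  exists g; split=> // k kS; apply/asboolP.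
  have [->|kg|] := trichotomy k g; [by left| |by right].
  have [b [Ub kgb _]] := top _ kS kg.
  have: b \in W by rewrite mem_filter Ub mem_finsupp -lt0n (leq_ltn_trans _ kgb).
  by rewrite W0.
have gT : g \in [pred k in S | omega_pow_le k g].
  by rewrite !inE gS; apply/asboolP; left.
have [|||z [zT z_min]] := IH b _ [pred k in S | omega_pow_le k g].
- by move: bW; rewrite mem_filter => /andP[].
- by exists g.
- suff Tg k c : k \in [pred k in S | omega_pow_le k g] -> wo_lt b c -> k c = g c.
    by move=> k k' kT k'T c bc; rewrite (Tg k) // (Tg k').
  rewrite !inE => /andP[kS /asboolP[->//|kg]] bc.
  have [d [Ud kgd kg_eq]] := top _ kS kg.
  apply: kg_eq; rewrite leNlt; apply/negP => cd.
  have dW : d \in W.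
    by rewrite mem_filter Ud mem_finsupp -lt0n (leq_ltn_trans _ kgd).
  by move: bc; rewrite leNlt (le_trans cd (b_max _ dW)).
move: (zT); rewrite !inE => /andP[zS zg]; exists z; split=> // k kS.
have [/orP kg|] := boolP ((k == g) || `[< omega_pow_lt k g >]).
  apply: z_min; rewrite !inE kS; apply/asboolP.
  by case: kg => [/eqP|/asboolP]; [left | right].
rewrite negb_or => /andP[/eqP nkg /asboolP kg]; apply: pow_le_trans zg _.
by apply/asboolP; right; have [/nkg|/kg|] := trichotomy k g.
Qed.

Lemma omega_pow_leP : well_order omega_pow_le.
Proof.
apply: antisymmetric_well_order => [f g|S S0].
  move=> /andP[/asboolP[//|fg] /asboolP[//|gf]].
  by have := lt_irr fg gf.
apply: (@min_step pred0) => // b _ {S S0}.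
apply: contrapT => Nb.
pose bad : {pred B} :=
  [pred b | `[< ~ forall S, nonempty S -> agree (wo_lt b) S -> has_min S >]].
have [|m [[/asboolP m_bad m_min] _]] := wo_leP (A := bad).
  by exists b; apply/asboolP.
apply: m_bad => S [g0 g0S] SU.
have exn : exists n, `[< exists2 f, f \in S & f m = n >].
  by exists (g0 m); apply/asboolP; exists g0.
have [n /asboolP[g gS gn] n_min] := ex_minnP exn.
have [z [zT z_min]] : has_min [pred f in S | f m == n].
  apply: (@min_step (fun c => wo_le m c)) => [c mc||].
  - apply: contrapT => c_bad; move/negP: mc; apply.
    by apply: m_min; apply/asboolP.
  - by exists g; rewrite !inE gS gn eqxx.
  - move=> f h; rewrite !inE => /andP[fS /eqP fm] /andP[hS /eqP hm] c mc.
    have [<-|nmc] := eqVneq m c; first by rewrite fm hm.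
    by apply: SU; rewrite // /wo_lt nmc.
move: zT; rewrite !inE => /andP[zS /eqP zm]; exists z; split=> // k kS.
have [km|km] := eqVneq (k m) n; first by apply: z_min; rewrite !inE kS km eqxx.
apply/asboolP; right; exists m; split; last by move=> c; apply: SU.
rewrite zm ltn_neqAle eq_sym km n_min //.
by apply/asboolP; exists k.
Qed.

Definition omega_pow : woType := WoType omega_pow_leP.

End OmegaPower.

Section CommutingProbability.
Local Open Scope ring_scope.

Definition commuting_pr (gT : finGroupType) (G : {group gT}) : rat :=
  #|[pred p : gT * gT |
      [&& p.1 \in G, p.2 \in G & (p.1 * p.2 == p.2 * p.1)%g]]|%:R
  / (#|G| ^ 2)%:R.

(* Commuting probabilities are rational, and rat carries the order induced by
   the order of the reals. *)
Definition commuting_prs : set rat :=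
  [set q | exists (gT : finGroupType) (G : {group gT}),
           q = commuting_pr G]%classic.

End CommutingProbability.

(* Main.v *)
Require Import Defs.
From mathcomp Require Import all_boot all_order all_algebra all_fingroup.
From mathcomp Require Import finmap boolp classical_sets functions wochoice.
From mathcomp Require Import archimedean ring lra zify.
From mathcomp Require Import all_solvable all_field all_character.
(* Restores the lemmas of fintype and finset that classical_sets shadows. *)
From mathcomp Require Import fintype finset.

(** The set P of commuting probabilities is closed under products, and its order
type is determined by two bounds.

Upper bound. If Pr(G) >= e then, by P. M. Neumann, G has a normal subgroup H of
class at most 2 with |G : H| and |H'| bounded in terms of e. Let d = |H'|. By
Clifford theory, Pr(G) lies between q = Pr(G/H')/d and q + Pr(H) - 1/d. Since
G/H' has an abelian normal subgroup of bounded index, q is a sum of boundedly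
many unit fractions up to a bounded denominator, and such q form a set of order
type below omega^omega. If Pr(G) > q + t, then Pr(H) > 1/d + t, and H contains
a subgroup of bounded index (in terms of t) with strictly smaller derived
subgroup. Induction on d shows that the probabilities of pairs (G, H) with
|G : H| <= m and |H'| <= d have order type at most omega^(omega d); hence every
proper initial segment of (P, >) has order type below omega^(omega^2).

Lower bound. If A and B are subsets of P bounded below by a positive number, of
types omega^a (a >= 1) and omega^b, then the products of the successors of A
with suitable tails of B contain a set of type omega^(b + a). Starting from the
extraspecial 2-groups this gives omega^k for every k. If (P, >) does not embed
in omega^omega, then a proper initial segment of P contains a copy of
omega^omega, whose products give omega^(omega k) for every k. *)

Set Implicit Arguments.
Unset Strict Implicit.
Unset Printing Implicit Defensive.

Import Order.TTheory GRing.Theory Num.Theory.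

(** * Comparison of well-orders *)

Section WellOrder.
Variable A : woType.
Implicit Types (x y z : A) (P : A -> Prop).

Lemma wo_total : total (@wo_le A).
Proof.
by move=> x y; apply: (@wo_chainW _ _ predT) => // D _; apply: wo_leP.
Qed.

Lemma wo_refl : reflexive (@wo_le A).
Proof. by move=> x; have := wo_total x x; rewrite orbb. Qed.

Lemma wo_anti x y : wo_le x y -> wo_le y x -> x = y.
Proof.
move=> xy yx; have anti := @wo_chain_antisymmetric _ (@wo_le A) predT.
apply: anti => //; last exact/andP.
by move=> D _; apply: wo_leP.
Qed.

Lemma wo_min P : (exists x, P x) ->
  exists2 x, P x & forall y, P y -> wo_le x y.
Proof.
move=> [x Px]; pose Pb : {pred A} := [pred x | `[< P x >]].
have [|m [[/asboolP Pm m_min] _]] := wo_leP (A := Pb).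
  by exists x; apply/asboolP.
by exists m => // y Py; apply: m_min; apply/asboolP.
Qed.

Lemma wo_ltNle x y : wo_lt x y = ~~ wo_le y x.
Proof.
rewrite /wo_lt; case: eqVneq => [->|/eqP xy] /=; first by rewrite wo_refl.
have := wo_total x y; case yx: (wo_le y x); last by rewrite orbF => ->.
by move=> _; apply/negP => xy'; apply: xy; apply: wo_anti.
Qed.

Lemma wo_leNlt x y : wo_le x y = ~~ wo_lt y x.
Proof. by rewrite wo_ltNle negbK. Qed.

Lemma wo_le_trans y x z : wo_le x y -> wo_le y z -> wo_le x z.
Proof.
move=> xy yz.
have [|w Pw w_min] := @wo_min (fun t => [\/ t = x, t = y | t = z]).
  by exists x; constructor 1.
have wx := w_min x (Or31 _ _ erefl); have wy := w_min y (Or32 _ _ erefl).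
have wz := w_min z (Or33 _ _ erefl).
case: Pw => ew; rewrite {}ew in wx wy wz => //.
  by rewrite (wo_anti xy wx).
by rewrite -(wo_anti yz wy).
Qed.

Lemma wo_ltW x y : wo_lt x y -> wo_le x y.
Proof. by case/andP. Qed.

Lemma wo_ltxx x : wo_lt x x = false.
Proof. by rewrite /wo_lt eqxx. Qed.

Lemma wo_le_lt_trans y x z : wo_le x y -> wo_lt y z -> wo_lt x z.
Proof.
by move=> xy; rewrite !wo_ltNle; apply: contraNN => zx; apply: wo_le_trans zx xy.
Qed.

Lemma wo_lt_le_trans y x z : wo_lt x y -> wo_le y z -> wo_lt x z.
Proof.
rewrite !wo_ltNle => yx yz; apply: contraNN yx => zx; exact: wo_le_trans yz zx.
Qed.

Lemma wo_lt_trans y x z : wo_lt x y -> wo_lt y z -> wo_lt x z.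
Proof. by move=> xy /wo_ltW; apply: wo_lt_le_trans. Qed.

Lemma wo_ltgt x y : [\/ x = y, wo_lt x y | wo_lt y x].
Proof.
have [->|xy] := eqVneq x y; first by constructor 1.
have /orP[] := wo_total x y => le; [constructor 2 | constructor 3].
  by rewrite /wo_lt xy.
by rewrite /wo_lt eq_sym xy.
Qed.

Lemma wo_le_eqVlt x y : wo_le x y -> x = y \/ wo_lt x y.
Proof. by move=> xy; case: (wo_ltgt x y); auto; rewrite wo_ltNle xy. Qed.

(** If x were least in the initial segment [P] with h x < x, then h (h x) < h x would make h x a
    smaller such element. *)
Lemma wo_expansive P (h : A -> A) :
  (forall x y, P y -> wo_lt x y -> P x) ->
  (forall x y, P x -> P y -> wo_lt x y -> wo_lt (h x) (h y)) ->
  forall x, P x -> wo_le x (h x).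
Proof.
move=> Pdown hmono x Px; apply: contrapT => /negP xhx.
have [|m [Pm mhm] m_min] := @wo_min (fun t => P t /\ ~~ wo_le t (h t)).
  by exists x.
rewrite -wo_ltNle in mhm; have Phm := Pdown _ _ Pm mhm.
have := m_min (h m); rewrite -wo_ltNle => /(_ (conj Phm (hmono _ _ Phm Pm mhm))).
by rewrite wo_leNlt mhm.
Qed.

End WellOrder.

(** * Comparing a reverse well-ordered set of rationals with an ordinal *)

Section Comparison.
Variables (A : woType) (S : rat -> Prop).
Implicit Types (w : A) (x y z : rat).
Local Open Scope ring_scope.

Definition antitone_on (f : rat -> A) :=
  forall x y, S x -> S y -> y < x -> wo_lt (f x) (f y).

Definition reverse_well_ordered :=
  forall P : rat -> Prop, (exists2 x, S x & P x) ->
  exists x, [/\ S x, P x & forall y, S y -> P y -> y <= x].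

Hypothesis a0 : A.
Hypothesis S_wo : reverse_well_ordered.

Let before y x := [/\ S y, S x & x < y].

Let before_wf : well_founded before.
Proof.
move=> a; apply: contrapT => aN.
have [|x [Sx Nx x_max]] := @S_wo (fun x => ~ Acc before x).
  exists a => //; apply: contrapT => NSa; apply: aN.
  by constructor => y [_ /NSa].
apply: Nx; constructor => y [Sy _ xy].
by apply: contrapT => /(x_max y Sy); rewrite leNgt xy.
Qed.

Let bounds (f : rat -> option A) x w :=
  forall y, before y x -> exists2 v, f y = Some v & wo_lt v w.

Let least P : option A :=
  if pselect (exists2 w, P w & forall v, P v -> wo_le w v) is left e
  then Some (s2val (cid2 e)) else None.

Let least_some P w : least P = Some w -> P w /\ forall v, P v -> wo_le w v.
Proof. by rewrite /least; case: pselect => // e [<-]; case: cid2. Qed.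

Let least_none P w : least P = None -> ~ P w.
Proof.
rewrite /least; case: pselect => // e _ Pw; apply: e; apply: wo_min.
by exists w.
Qed.

(** Well-founded recursion. For x in [S], the rank is the least strict bound of the ranks of the
    larger elements; it is [None] if there is no such bound or one of those ranks is already
    [None]. *)
Let rank_exists : exists f, forall x, f x = least (bounds f x).
Proof.
pose G x (r : forall y, before y x -> option A) :=
  let r' y := if pselect (before y x) is left h then r y h else None in
  least (bounds r' x).
exists (Fix before_wf (fun=> option A) G) => x.
rewrite Fix_eq; last first.
  move=> {}x r1 r2 r12; congr (G _ _).
  by apply: functional_extensionality_dep => y; apply: funext => h.
rewrite /G; congr least; apply: funext => w; apply: propext.
split=> b y yx; have [v] := b y yx; case: pselect => // _ fv vw; exists v => //.
Qed.

(** If every element of [S] has a rank, the ranks form an initial segment of [A]. Otherwise the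
    ranks above the largest element x without one exhaust [A], and inverting them gives [g]. *)
Lemma wo_comparison :
  (exists f : rat -> A, antitone_on f /\
     forall x w, S x -> wo_lt w (f x) -> exists2 y, S y & f y = w)
  \/ exists (x : rat) (g : A -> rat), [/\ S x,
       forall w, S (g w) /\ x < g w & forall v w, wo_lt v w -> g w < g v].
Proof.
have [f fE] := rank_exists.
(* A value w that is not a strict bound of the ranks before x is attained: for the largest y before
   x of rank at least w, w bounds the ranks before y, so the rank of y is exactly w. *)
have f_hit x w : S x -> (forall y, before y x -> f y <> None) ->
    ~ bounds f x w -> exists2 y, before y x & f y = Some w.
  move=> Sx fx Nb.
  pose over y := before y x /\ forall v, f y = Some v -> wo_le w v.
  have [|y [Sy [yx wy] y_max]] := @S_wo over.
    apply: contrapT => Nover; apply: Nb => y yx.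
    case fy: (f y) (fx y yx) => [v|//] _; exists v => //.
    rewrite wo_ltNle; apply/negP => wv; apply: Nover; exists y; first by case: yx.
    by split=> // _ /(etrans (esym fy))[<-].
  exists y => //; case fy: (f y) (fx y yx) => [v|//] _; congr Some.
  have := fy; rewrite fE => /least_some[_ v_min].
  apply: wo_anti; last exact: wy.
  apply: v_min => z [Sz _ yz].
  have zx : before z x by split=> //; case: yx => _ _ /lt_trans; apply.
  case fz: (f z) (fx z zx) => [u|//] _; exists u => //.
  rewrite wo_ltNle; apply/negP => wu.
  have /y_max : over z by split=> // _ /(etrans (esym fz))[<-].
  by move=> /(_ Sz); rewrite leNgt yz.
have f_mono x y v w : before x y -> f x = Some v -> f y = Some w -> wo_lt v w.
  move=> xy fx; rewrite fE => /least_some[/(_ x xy)[v' + v'w] _].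
  by rewrite fx => -[->].
have [allS|] := pselect (forall x, S x -> f x <> None).
  left; exists (fun x => odflt a0 (f x)); split=> [x y Sx Sy yx|x w Sx].
    case fx: (f x) (allS x Sx) => [v|//] _; case fy: (f y) (allS y Sy) => [w|//] _.
    exact: f_mono fx fy.
  case fx: (f x) (allS x Sx) => [v|//] _ /= wv.
  have [||y [Sy _ _] fy] := f_hit x w Sx.
  - by move=> y [Sy _ _]; apply: allS.
  - by move: fx; rewrite fE => /least_some[_ v_min] /v_min; rewrite wo_leNlt wv.
  - by exists y; rewrite // fy.
move=> /existsNP[z /not_implyP[Sz Nfz]]; right.
have [|x [Sx fxN x_max]] := @S_wo (fun x => f x = None).
  by exists z => //; apply: contrapT.
have hit w : exists y, before y x /\ f y = Some w.
  have [||y yx fy] := f_hit x w Sx; last by exists y.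
  - by move=> y [Sy _ xy] /(x_max _ Sy); rewrite leNgt xy.
  - by move: fxN; rewrite fE => /least_none; apply.
have [g gP] := choice hit; exists x, g; split=> // [w|v w vw].
  by have [[]] := gP w.
have [[Sv _ _] fv] := gP v; have [[Sw _ _] fw] := gP w.
rewrite ltNge le_eqVlt; apply/negP => /predU1P[vwE|gvw].
  by move: fv vw; rewrite vwE fw => -[->]; rewrite wo_ltxx.
have /(f_mono (g w) (g v) _ _)/(_ fw fv) : before (g w) (g v) by [].
by move=> /(wo_lt_trans vw); rewrite wo_ltxx.
Qed.

(** The map [f] bounds the type of [S] by that of [A]; the initial segments [D], which cover [A] and
    embed into [S], exclude every smaller type. *)
Lemma antitone_has_order_type (f : rat -> A) : antitone_on f ->
    (forall w0 : A, exists (D : A -> Prop) (g : A -> rat),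
       [/\ D w0, forall v w, D w -> wo_lt v w -> D v, forall w, D w -> S (g w)
         & forall v w, D v -> D w -> wo_lt v w -> g w < g v]) ->
  has_order_type S (fun x y : rat => y <= x) A.
Proof.
move=> f_anti gP.
have no_bound (h : rat -> A) (w0 : A) : antitone_on h ->
    (forall x, S x -> wo_lt (h x) w0) -> False.
  move=> h_anti hw0; have [D [g [Dw0 D_down gS g_anti]]] := gP w0.
  have: wo_le w0 (h (g w0)).
    apply: (wo_expansive (h := h \o g) D_down _ Dw0) => v w Dv Dw vw.
    by apply: h_anti; [apply: gS..|apply: g_anti].
  by rewrite wo_leNlt hw0 //; apply: gS.
have [[h [h_anti h_down]]|[x [g [Sx gS g_anti]]]] := wo_comparison; last first.
  (* The increasing map [f \o g] of [A] would send [f x] strictly below itself. *)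
  exfalso; have: wo_le (f x) (f (g (f x))).
  apply: (@wo_expansive A (fun=> True) (f \o g) _ _ (f x)) => // v w _ _ vw /=.
    by apply: f_anti; [apply: (gS _).1..|apply: g_anti].
  by rewrite wo_leNlt f_anti //; have [] := gS (f x).
have h_inj x y : S x -> S y -> h x = h y -> x = y.
  move=> Sx Sy hxy; case: (ltgtP x y) => // xy.
    by have := h_anti _ _ Sy Sx xy; rewrite hxy wo_ltxx.
  by have := h_anti _ _ Sx Sy xy; rewrite hxy wo_ltxx.
exists h; split; first split=> //.
- by move=> x y; rewrite !in_setE; apply: h_inj.
- move=> w _; apply: contrapT => Nw; apply: (no_bound h w) => // x Sx.
  have [xw|//|/(h_down _ _ Sx)[y Sy hy]] := wo_ltgt (h x) w; case: Nw.
    by exists x.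
  by exists y.
- move=> x y; rewrite !in_setE => Sx Sy; case: (ltgtP x y) => xy.
  + by rewrite wo_leNlt h_anti.
  + by rewrite wo_ltW // h_anti.
  + by rewrite xy wo_refl.
Qed.
End Comparison.

(** * Powers of omega *)

Notation code K := {fsfun wo_sort K -> nat with 0}.

Lemma omega_powE (K : woType) (u v : code K) :
  @wo_lt (omega_pow K) u v <-> omega_pow_lt u v.
Proof.
have lt_irr (f : code K) : ~ omega_pow_lt f f by move=> [b []]; rewrite ltnn.
rewrite /wo_lt /= /omega_pow_le; split.
  by move=> /andP[/eqP uv /asboolP[]].
move=> uv; apply/andP; split; last by apply/asboolP; right.
by apply: contra_not_neq (@lt_irr u) => {2}->.
Qed.

(** * Natural sums of codes *)

Section Codes.
Variable K : woType.
Implicit Types (u v w : code K) (c e : K).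

Definition code_le u v := u = v \/ omega_pow_lt u v.

Lemma code_leE u v : @wo_le (omega_pow K) u v <-> code_le u v.
Proof. by split=> /asboolP. Qed.

(** The natural (Hessenberg) sum of ordinals, which is strictly monotone in both arguments. *)
Definition code_add u v : code K :=
  [fsfun c in (finsupp u `|` finsupp v)%fset => u c + v c].

Lemma code_addE u v c : code_add u v c = u c + v c.
Proof.
rewrite fsfun_fun in_fsetU !mem_finsupp.
by case: eqP => [->|] //=; case: eqP => [->|].
Qed.

Lemma code_addC u v : code_add u v = code_add v u.
Proof. by apply/fsfunP => c; rewrite !code_addE addnC. Qed.

Lemma code_lt_add u u' v v' :
  omega_pow_lt u u' -> code_le v v' -> omega_pow_lt (code_add u v) (code_add u' v').
Proof.
move=> [b [ub uE]] [<-|[c [vc vE]]].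
  exists b; rewrite !code_addE ltn_add2r; split=> // d bd.
  by rewrite !code_addE uE.
have [bc|bc|cb] := wo_ltgt b c.
- rewrite bc in ub uE *; exists c; rewrite !code_addE; split.
    by rewrite -addnS leq_add // ltnW.
  by move=> d cd; rewrite !code_addE uE // vE.
- exists c; rewrite !code_addE uE // ltn_add2l; split=> // d cd.
  by rewrite !code_addE vE // uE //; apply: wo_lt_trans cd.
- exists b; rewrite !code_addE vE // ltn_add2r; split=> // d bd.
  by rewrite !code_addE uE // vE //; apply: wo_lt_trans bd.
Qed.

Lemma code_le_add u u' v v' :
  code_le u u' -> code_le v v' -> code_le (code_add u v) (code_add u' v').
Proof.
move=> [->|uu']; last by right; apply: code_lt_add.
move=> [->|vv']; first by left.
by right; rewrite !(code_addC u'); apply: code_lt_add => //; left.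
Qed.

Definition code_unit e n : code K := [fsfun c in [fset e]%fset => n].

Lemma code_unitE e n c : code_unit e n c = if c == e then n else 0.
Proof. by rewrite fsfun_fun in_fset1. Qed.

Lemma code_unit_le e m n : m <= n -> code_le (code_unit e m) (code_unit e n).
Proof.
rewrite leq_eqVlt => /predU1P[->|mn]; first by left.
right; exists e; rewrite !code_unitE eqxx; split=> // c ec.
by rewrite !code_unitE; case: eqP ec => // ->; rewrite wo_ltxx.
Qed.

(** Equivalently, u < omega^e as ordinals. *)
Definition below e u := forall c, wo_le e c -> u c = 0.

Lemma below_add e u v : below e u -> below e v -> below e (code_add u v).
Proof. by move=> ue ve c ec; rewrite code_addE ue ?ve. Qed.

Lemma below_trans e e' u : wo_le e e' -> below e u -> below e' u.
Proof. by move=> ee' ue c e'c; apply: ue; apply: wo_le_trans e'c. Qed.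

Lemma below_lt_unit e u : below e u -> omega_pow_lt u (code_unit e 1).
Proof.
move=> ue; exists e; rewrite code_unitE eqxx ue ?wo_refl //; split=> // c ec.
rewrite ue ?wo_ltW // code_unitE; case: eqP ec => // ->.
by rewrite wo_ltxx.
Qed.

Lemma le_unit_below e e' u :
  wo_lt e e' -> code_le u (code_unit e 1) -> below e' u.
Proof.
move=> ee' ule c e'c.
have ce : (c == e) = false.
  by apply: contraTF e'c => /eqP->; rewrite -wo_ltNle.
case: ule => [->|[b [ub uE]]]; first by rewrite code_unitE ce.
rewrite uE ?code_unitE ?ce //; move: ub; rewrite code_unitE.
by case: eqP => // -> _; apply: wo_lt_le_trans ee' e'c.
Qed.

End Codes.

Section Embedding.
Variables K K' : woType.
Variable s : K -> K'.
Hypothesis s_mono : forall c d, wo_lt c d -> wo_lt (s c) (s d).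

Lemma wo_mono_inj : injective s.
Proof.
move=> c d scd; case: (wo_ltgt c d) => // /s_mono; rewrite scd wo_ltxx //.
Qed.

Lemma code_shift_exists (u : code K) : exists v : code K',
  (forall c, v (s c) = u c) /\ (forall d, (forall c, d <> s c) -> v d = 0).
Proof.
exists [fsfun d in [fset s c | c in finsupp u]%fset =>
  if pselect (exists c, d = s c) is left e then u (projT1 (cid e)) else 0].
split=> [c|d dN]; rewrite fsfun_fun; last first.
  by case: ifP => // /imfsetP[c _ /dN].
case: imfsetP => [_|Nc].
  case: pselect => [e|[]]; last by exists c.
  by case: cid => c' /= /wo_mono_inj->.
apply/esym/eqP/negPn/negP => uc; apply: Nc; exists c => //.
by rewrite mem_finsupp.
Qed.

Lemma code_shift : exists t : code K -> code K',
  [/\ forall u c, t u (s c) = u c,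
      forall u d, (forall c, d <> s c) -> t u d = 0
    & forall u v, omega_pow_lt u v -> omega_pow_lt (t u) (t v)].
Proof.
have [t tP] := choice code_shift_exists; exists t.
have ts u c : t u (s c) = u c by have [] := tP u.
have t0 u d : (forall c, d <> s c) -> t u d = 0 by have [_] := tP u; apply.
split=> // u v [b [uvb uvE]]; exists (s b); rewrite !ts; split=> // d bd.
have [[c dE]|dN] := pselect (exists c, d = s c); last first.
  by rewrite !t0 // => c dc; apply: dN; exists c.
rewrite dE !ts; apply: uvE; case: (wo_ltgt b c) => // [bc|/s_mono cb].
  by rewrite dE bc wo_ltxx in bd.
by rewrite dE in bd; have := wo_lt_trans cb bd; rewrite wo_ltxx.
Qed.

End Embedding.

(** * Upper bounds on order types of sets of rationals *)

Section OrderTypeBound.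
Variable K : woType.
Implicit Types (e : K) (S : rat -> Prop) (x y t : rat).
Local Open Scope ring_scope.

(* [ot_le e S]: the order type of [(S, >)] is at most [omega ^ e]. *)
Definition ot_le e S := exists f : rat -> code K,
  (forall x, S x -> below e (f x)) /\
  (forall x y, S x -> S y -> y < x -> omega_pow_lt (f x) (f y)).

(** Here [f] is monotone on all rationals, so that the functions of two different sets can be
    added. *)
Definition ot_le_total e S := exists f : rat -> code K,
  [/\ forall x, below e (f x),
      forall x y, y <= x -> code_le (f x) (f y)
    & forall x y, S x -> y < x -> omega_pow_lt (f x) (f y)].

Lemma ot_le_sub e e' S S' : wo_le e e' -> (forall x, S' x -> S x) ->
  ot_le e S -> ot_le e' S'.
Proof.
move=> ee' SS' [f [f_below f_anti]]; exists f; split=> [x|x y] /SS' Sx.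
  by apply: below_trans ee' _; apply: f_below.
by move=> /SS' Sy; apply: f_anti.
Qed.

Lemma ot_le_preimage e S (h : rat -> rat) :
  {homo h : x y / x < y} -> ot_le e S -> ot_le e (fun x => S (h x)).
Proof.
move=> h_mono [f [f_below f_anti]]; exists (f \o h); split=> [x|x y] /=.
  exact: f_below.
by move=> Sx Sy xy; apply: f_anti => //; apply: h_mono.
Qed.

Lemma ot_le_total_le e S : ot_le_total e S -> ot_le e S.
Proof. by move=> [f [f_below _ f_anti]]; exists f; split=> // x y Sx _; apply: f_anti. Qed.

(** A rational x is sent to the least strict bound of [f] on the elements of [S] above x. This can
    be omega^e itself, hence the larger exponent. *)
Lemma ot_le_extend e e' S : wo_lt e e' -> ot_le e S -> ot_le_total e' S.
Proof.
move=> ee' [f [f_below f_anti]].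
pose bnd x (w : omega_pow K) := forall a, S a -> x < a -> omega_pow_lt (f a) w.
have min_bnd x : exists w : code K,
    bnd x w /\ forall v : code K, bnd x v -> code_le w v.
  have [|w bw w_min] := @wo_min (omega_pow K) (bnd x).
    by exists (code_unit e 1) => a Sa _; apply: below_lt_unit; apply: f_below.
  by exists w; split=> // v /w_min /code_leE.
have [g gP] := choice min_bnd.
exists g; split=> [x|x y yx|x y Sx yx].
- apply: (le_unit_below ee'); apply: (gP x).2 => a Sa _.
  by apply: below_lt_unit; apply: f_below.
- apply: (gP x).2 => a Sa xa; apply: (gP y).1 => //.
  exact: le_lt_trans xa.
- have gx : code_le (g x) (f x) by apply: (gP x).2 => a Sa; apply: f_anti.
  have gy : omega_pow_lt (f x) (g y) by apply: (gP y).1.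
  apply/omega_powE; move/omega_powE: gy; apply: wo_le_lt_trans.
  exact/code_leE.
Qed.

Lemma ot_le_total_setU e S S' : ot_le_total e S -> ot_le_total e S' ->
  ot_le_total e (fun x => S x \/ S' x).
Proof.
move=> [f [f_below f_le f_anti]] [g [g_below g_le g_anti]].
exists (fun x => code_add (f x) (g x)); split=> [x|x y yx|x y Sx yx].
- exact: below_add.
- by apply: code_le_add; [apply: f_le|apply: g_le].
- case: Sx => Sx; first by apply: code_lt_add; [apply: f_anti|apply/g_le/ltW].
  rewrite !(code_addC (f _)).
  by apply: code_lt_add; [apply: g_anti|apply/f_le/ltW].
Qed.

(** However many sets there are, one step from [e] to [e'] is enough: after extension their
    functions are added, and the codes below omega^e' are closed under natural sums. *)
Lemma ot_le_bigcup e e' (n : nat) (S : nat -> rat -> Prop) : wo_lt e e' ->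
  (forall i : nat, (i < n)%N -> ot_le e (S i)) ->
  ot_le e' (fun x => exists2 i : nat, (i < n)%N & S i x).
Proof.
move=> ee' Se; apply: ot_le_total_le.
elim: n Se => [|n IH] Se.
  exists (fun=> [fsfun]); split=> [x c _|x y _|x y []//]; first by rewrite fsfun0E.
  by left.
have [||f [f_below f_le f_anti]] := @ot_le_total_setU e' _ (S n) (IH _).
- by move=> i /ltnW; apply: Se.
- by apply: ot_le_extend ee' _; apply: Se.
exists f; split=> // x y [i] ; rewrite ltnS leq_eqVlt => /predU1P[->|iN] Sx.
  by apply: f_anti; right.
by apply: f_anti; left; exists i.
Qed.

Lemma ot_le_setU e e' S S' : wo_lt e e' -> ot_le e S -> ot_le e S' ->
  ot_le e' (fun x => S x \/ S' x).
Proof.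
move=> ee' Se Se'; apply: ot_le_total_le.
by apply: ot_le_total_setU; apply: ot_le_extend ee' _.
Qed.

Lemma ot_le_set1 e x : ot_le e (fun y => y = x).
Proof.
exists (fun=> [fsfun]); split=> [y _ c _|y z -> ->]; first by rewrite fsfun0E.
by rewrite ltxx.
Qed.

Lemma ot_le_rwo e S : ot_le e S -> reverse_well_ordered S.
Proof.
move=> [f [_ f_anti]] P [a Sa Pa].
have [|w [x [Sx Px <-]] x_min] :=
  @wo_min (omega_pow K) (fun w => exists x, [/\ S x, P x & f x = w]).
  by exists (f a), a.
exists x; split=> // y Sy Py; rewrite leNgt; apply/negP => xy.
have /omega_powE : omega_pow_lt (f y) (f x) by apply: f_anti.
by rewrite wo_ltNle x_min //; exists y.
Qed.

(** The fibres of [h] are consecutive blocks of [S]. The coefficients from [e] on locate the block,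
    and those below [e] the position inside it. *)
Lemma ot_le_blocks e e' S (h : rat -> code K) : wo_le e e' ->
  (forall x c, S x -> wo_lt c e -> h x c = 0%N) ->
  (forall x, S x -> below e' (h x)) ->
  (forall x y, S x -> S y -> y < x -> code_le (h x) (h y)) ->
  (forall w, ot_le e (fun x => S x /\ h x = w)) -> ot_le e' S.
Proof.
move=> ee' h_above h_below h_le blk.
have [lo loP] := choice blk.
exists (fun x => code_add (h x) (lo (h x) x)); split=> [x Sx|x y Sx Sy yx].
  by apply: below_add; [apply: h_below|apply: below_trans ee' _; apply: (loP _).1].
have [hxy|[b [hb hE]]] := h_le x y Sx Sy yx.
  rewrite hxy !(code_addC (h y)); apply: code_lt_add; last by left.
  by apply: (loP _).2.
have eb : wo_le e b.
  by rewrite wo_leNlt; apply/negP => /(h_above y); move: hb => /[swap]->.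
have lo0 z c : S z -> wo_le e c -> lo (h z) z c = 0%N.
  by move=> Sz; apply: ((loP (h z)).1 z (conj Sz erefl)).
exists b; rewrite !code_addE !lo0 // !addn0; split=> // c bc.
have ec : wo_le e c by apply: wo_le_trans eb (wo_ltW bc).
by rewrite !code_addE !lo0 // hE.
Qed.

(** Sort x first by [p x], encoded above [e], then by the integer part n of 1 / (x - p x), stored as
    the coefficient at [e]. In a block n is fixed, so x - p x > 1 / (n + 1) and the last hypothesis
    applies. *)
Lemma ot_le_above e e' S Q (p : rat -> rat) (h : rat -> code K) : wo_lt e e' ->
  (forall x, S x -> [/\ Q (p x), p x < x & forall y, S y -> y < x -> p y <= p x]) ->
  (forall q c, Q q -> wo_le c e -> h q c = 0%N) ->
  (forall q, Q q -> below e' (h q)) ->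
  (forall q r, Q q -> Q r -> r < q -> omega_pow_lt (h q) (h r)) ->
  (forall t, 0 < t -> ot_le e (fun x => S x /\ p x + t < x)) -> ot_le e' S.
Proof.
move=> ee' pP h_above h_below h_anti gap.
pose n x := Num.truncn (x - p x)^-1.
pose H x := code_add (h (p x)) (code_unit e (n x)).
have QP x : S x -> Q (p x) by case/pP.
have H_e x : S x -> H x e = n x.
  by move=> /QP Qx; rewrite code_addE h_above ?wo_refl // code_unitE eqxx.
apply: (@ot_le_blocks e e' S H) => [|x c /QP Qx ce|x /QP Qx|x y Sx Sy yx|w].
- exact: wo_ltW.
- rewrite code_addE h_above ?wo_ltW // code_unitE; case: eqP ce => // ->.
  by rewrite wo_ltxx.
- apply: below_add; first exact: h_below.
  move=> c e'c; rewrite code_unitE; case: eqP e'c => // ->.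
  by rewrite wo_leNlt ee'.
- have [Qx px px_min] := pP x Sx; have [Qy py _] := pP y Sy.
  have := px_min y Sy yx; rewrite le_eqVlt => /predU1P[pE|pxy]; last first.
    right; have [b [hb hE]] := h_anti _ _ Qx Qy pxy.
    have eb : wo_lt e b.
      by rewrite wo_ltNle; apply/negP => /(h_above _ _ Qy); move: hb => /[swap]->.
    have u0 m c : wo_lt e c -> code_unit e m c = 0%N.
      by rewrite code_unitE; case: eqP => // ->; rewrite wo_ltxx.
    exists b; rewrite !code_addE !u0 // !addn0; split=> // c bc.
    by rewrite !code_addE hE // !u0 //; apply: wo_lt_trans bc.
  rewrite /H pE; apply: code_le_add; [by left|apply: code_unit_le].
  rewrite /n pE; apply: le_truncn; rewrite lef_pV2 ?posrE ?subr_gt0 //.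
    by rewrite lerD2r ltW.
  by rewrite -pE.
- have [m mE] : exists m, m = w e by exists (w e).
  have m_gt0 : 0 < (m.+1%:R : rat)^-1 by rewrite invr_gt0 ltr0Sn.
  apply: ot_le_sub (wo_refl e) _ (gap _ m_gt0) => x [Sx Hx]; split=> //.
  have [_ px _] := pP x Sx; rewrite addrC -ltrBrDr.
  rewrite invf_plt ?posrE ?ltr0Sn ?subr_gt0 //.
  by rewrite mE -Hx H_e //; apply: truncnS_gt.
Qed.

Lemma ot_le_gt0 e e' S : wo_lt e e' ->
  (forall t, 0 < t -> ot_le e (fun x => S x /\ t < x)) ->
  ot_le e' (fun x => S x /\ 0 < x).
Proof.
move=> ee' gap; apply: (@ot_le_above e e' _ (fun q => q = 0) (fun=> 0) (fun=> [fsfun])).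
- by [].
- by move=> x [].
- by move=> q c _ _; rewrite fsfun0E.
- by move=> q _ c _; rewrite fsfun0E.
- by move=> q r -> ->; rewrite ltxx.
- move=> t t0; apply: ot_le_sub (wo_refl e) _ (gap t t0) => x [[Sx _]].
  by rewrite add0r.
Qed.

End OrderTypeBound.

(** * Sums of boundedly many unit fractions *)

Section EgyptianSums.
Local Open Scope ring_scope.

Fixpoint egyptian (m : nat) (x : rat) : Prop :=
  if m is k.+1 then
    exists2 y, egyptian k y & x = y \/ exists n : nat, x = y + n.+1%:R^-1
  else x = 0.

Lemma egyptian_ge0 m x : egyptian m x -> 0 <= x.
Proof.
elim: m x => [x ->//|m IH x [y /IH y0 [->//|[n ->]]]].
by rewrite addr_ge0 // invr_ge0 ler0n.
Qed.

Lemma egyptian_sum (I : Type) (s : seq I) (F : I -> rat) :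
  (forall i, F i = 0 \/ exists n : nat, F i = n.+1%:R^-1) ->
  egyptian (size s) (\sum_(i <- s) F i).
Proof.
move=> FP; elim: s => [|i s IH]; first by rewrite big_nil.
rewrite big_cons /=; exists (\sum_(j <- s) F j) => //.
have [->|[n ->]] := FP i; first by left; rewrite add0r.
by right; exists n; rewrite addrC.
Qed.

(** By pigeonhole one of the at most m + 1 terms exceeds c; it is split off. *)
Lemma egyptian_large_term m c x : 0 < c -> egyptian m.+1 x -> m.+1%:R * c < x ->
  exists n : nat, c < n.+1%:R^-1 /\ egyptian m (x - n.+1%:R^-1).
Proof.
move=> c0; elim: m x => [|m IH] x [y Ey xE] cx.
  case: xE => [xy|[n xE]].
    by move: cx; rewrite xy Ey mul1r => /(lt_trans c0); rewrite ltxx.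
  by exists n; move: cx; rewrite xE Ey add0r mul1r subrr.
have IHy : m.+1%:R * c < y -> exists n : nat, c < n.+1%:R^-1 /\
    egyptian m.+1 (x - n.+1%:R^-1).
  move=> /(IH _ Ey)[n [cn En]]; exists n; split=> //; exists (y - n.+1%:R^-1) => //.
  by case: xE => [->|[k ->]]; [left|right; exists k; rewrite addrAC].
have mc : m.+1%:R * c < m.+2%:R * c by rewrite ltr_pM2r // ltr_nat.
case: (xE) => [xy|[n xy]]; first by apply: IHy; rewrite -xy; apply: lt_trans cx.
have [cn|nc] := ltP c n.+1%:R^-1.
  by exists n; split=> //; rewrite xy addrK.
apply: IHy; rewrite -(ltrD2r n.+1%:R^-1) -xy; apply: le_lt_trans cx.
by rewrite -[m.+2%:R]natr1 mulrDl mul1r lerD2l.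
Qed.

(** A sum of m + 1 terms above t has a term above t / (m + 1), which leaves finitely many choices
    for that term. So the part above t lies in finitely many translates of the set for m. *)
Lemma egyptian_ot_le m : exists e : nat, @ot_le wo_omega e (egyptian m).
Proof.
have ltS (e : nat) : @wo_lt wo_omega e e.+1.
  by rewrite /wo_lt /= leqnSn ltn_eqF.
elim: m => [|m [e IH]]; first by exists 0%N; apply: ot_le_set1.
(* One step for the finite union, one for letting t tend to 0, one for adjoining the point 0. *)
exists e.+3.
apply: (@ot_le_sub wo_omega e.+3 e.+3 (fun x => x = 0 \/ egyptian m.+1 x /\ 0 < x)).
- exact: wo_refl.
- move=> x Ex; have := egyptian_ge0 Ex; rewrite le_eqVlt => /predU1P[<-|x0].
    by left.
  by right.
apply: ot_le_setU (ltS e.+2) (ot_le_set1 _ _) _.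
apply: ot_le_gt0 (ltS e.+1) _ => t t0.
have c0 : 0 < t / m.+1%:R by rewrite divr_gt0 ?ltr0Sn.
pose N := Num.truncn (t / m.+1%:R)^-1.
apply: ot_le_sub (wo_refl _) _
  (@ot_le_bigcup _ _ _ N.+1 (fun n x => egyptian m (x - n.+1%:R^-1)) (ltS e) _).
  move=> x [Ex tx]; have [|n [cn En]] := egyptian_large_term c0 Ex.
    by rewrite mulrC divfK ?pnatr_eq0.
  exists n => //; apply: ltnW; rewrite ltnS -ltnS.
  rewrite -(ltr_nat rat) (lt_le_trans _ (ltW (truncnS_gt _))) //.
  by rewrite -(invrK n.+1%:R) ltf_pV2 ?posrE ?invr_gt0 ?ltr0Sn.
move=> n _; apply: (@ot_le_preimage wo_omega e (egyptian m)) IH => x y xy.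
by rewrite ltrD2r.
Qed.

End EgyptianSums.

(** * Lower bounds on order types from products *)

Section LowerBound.
Variable S : rat -> Prop.
Local Open Scope ring_scope.
Hypothesis S_mul : forall x y, S x -> S y -> S (x * y).

(* [ot_ge e S]: some bounded below part of [(S, >)] has order type at least
   [omega ^ e]. *)
Definition ot_ge (K : woType) (e : K) := exists (g : code K -> rat) (x : rat),
  [/\ 0 < x, forall u, below e u -> S (g u) /\ x <= g u
    & forall u v, below e u -> below e v -> omega_pow_lt u v -> g v < g u].

(** A code below omega^e' is ordered by [hi u] in [A], then by its coefficients below [e]. The block
    of a uses products of [g (s a)], s a being the successor of a, with a tail of [gB] so short that
    the block stays below [g a] times any value of [gB]; hence blocks do not overlap. *)
Lemma ot_ge_mul (K A : woType) (e e' : K) (hi : code K -> A) (s : A -> A)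
    (g : A -> rat) (x : rat) :
  (forall a, wo_lt a (s a)) -> (forall a b, wo_lt a b -> wo_le (s a) b) ->
  0 < x -> (forall a, S (g a) /\ x <= g a) ->
  (forall a b, wo_lt a b -> g b < g a) ->
  (forall u v, below e' u -> below e' v -> omega_pow_lt u v ->
     (forall c, wo_le e c -> u c = v c) \/ wo_lt (hi u) (hi v)) ->
  (forall u v, below e' u -> below e' v -> (forall c, wo_le e c -> u c = v c) ->
     hi u = hi v) ->
  ot_ge e -> ot_ge e'.
Proof.
move=> s_gt s_min x0 gP g_anti hi_lt hi_eq [gB [y [y0 gBP gB_anti]]].
have g_gt0 a : 0 < g a by apply: lt_le_trans x0 (gP a).2.
have gB_gt0 u : below e u -> 0 < gB u by move=> ue; apply: lt_le_trans y0 (gBP u ue).2.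
(* Otherwise every value of [gB] could be lowered by the fixed amount d = (g a / g (s a) - 1) y,
   since all values are at least y; repeating this contradicts positivity. *)
have tail a : exists b0 : code K, below e b0 /\
    forall b, below e b -> g (s a) * gB b0 < g a * gB b.
  apply: contrapT => Nb0.
  have [d d0 dP] : exists2 d : rat, 0 < d & forall b0, below e b0 -> exists2 b,
      below e b & gB b + d <= gB b0.
    exists ((g a / g (s a) - 1) * y).
      by rewrite mulr_gt0 // subr_gt0 ltr_pdivlMr // mul1r g_anti.
    move=> b0 b0e; apply: contrapT => Nb; apply: Nb0; exists b0; split=> // b be.
    rewrite ltNge; apply/negP => le; apply: Nb; exists b => //.
    rewrite -(ler_pM2l (g_gt0 (s a))); apply: le_trans le.
    rewrite mulrDr mulrA mulrBr mulrCA divff ?gt_eqF // !mulr1 mulrBl.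
    have := (gBP b be).2; have : g (s a) < g a by apply: g_anti.
    by nra.
  have descend n : exists2 b, below e b & gB b + d *+ n <= gB [fsfun].
    elim: n => [|n [b be bn]].
      by exists [fsfun] => [c _|]; rewrite ?fsfun0E // addr0.
    have [b' b'e b'b] := dP b be; exists b' => //.
    by rewrite mulrS addrA (le_trans _ bn) // lerD2r.
  have [b be] := descend (Num.truncn (gB [fsfun] / d)).+1.
  have := truncnS_gt (gB [fsfun] / d); rewrite ltr_pdivrMr // mulr_natl.
  by have := gB_gt0 b be; move: (_ *+ _) => z; lra.
have [b0 b0P] := choice tail.
have [lo loP] : exists lo : code K -> code K, forall u,
    below e (lo u) /\ forall c, wo_lt c e -> lo u c = u c.
  exists (fun u => [fsfun c in finsupp u => if wo_lt c e then u c else 0%N]).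
  move=> u; split=> c ce; rewrite fsfun_fun mem_finsupp.
    by move: ce; rewrite wo_leNlt => /negbTE->; case: ifP.
  by rewrite ce; case: eqP.
(* The natural sum moves the low part into the tail starting at [b0 (hi u)] and preserves strict
   order. *)
pose t u := code_add (lo u) (b0 (hi u)).
have t_below u : below e (t u).
  by apply: below_add; [apply: (loP _).1|apply: (b0P _).1].
exists (fun u => g (s (hi u)) * gB (t u)), (x * y); split=> [|u ue'|u v ue' ve' uv].
- exact: mulr_gt0.
- split; first by apply: S_mul; [apply: (gP _).1|apply: (gBP _ _).1].
  by apply: ler_pM; [exact: ltW|exact: ltW|apply: (gP _).2|apply: (gBP _ _).2].
- have [uvE|hi_uv] := hi_lt u v ue' ve' uv.
    have hE := hi_eq u v ue' ve' uvE; rewrite hE ltr_pM2l //.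
    apply: gB_anti => //; rewrite /t hE; apply: code_lt_add; last by left.
    case: uv => b [ub bE].
    have be : wo_lt b e.
      by rewrite wo_ltNle; apply/negP => /uvE ubE; rewrite ubE ltnn in ub.
    exists b; rewrite !(loP _).2 //; split=> // c bc.
    have [ec|] := boolP (wo_le e c); first by rewrite !(loP _).1.
    by rewrite -wo_ltNle => ce; rewrite !(loP _).2 // bE.
  have tv : gB (t v) <= gB (b0 (hi v)).
    have [e0|lo0] := eqVneq (lo v) [fsfun].
      suff -> : t v = b0 (hi v) by [].
      by apply/fsfunP => c; rewrite code_addE e0 fsfun0E.
    apply/ltW/gB_anti => //; first exact: (b0P _).1.
    have -> : b0 (hi v) = code_add [fsfun] (b0 (hi v)).
      by apply/fsfunP => c; rewrite code_addE fsfun0E.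
    apply: code_lt_add; last by left.
    apply/omega_powE; rewrite wo_ltNle; apply/negP => /code_leE[le0|[b []]].
      by rewrite le0 eqxx in lo0.
    by rewrite fsfun0E.
  have lt1 : g (s (hi v)) * gB (t v) < g (hi v) * gB (t u).
    apply: le_lt_trans ((b0P (hi v)).2 _ (t_below u)).
    by rewrite ler_pM2l.
  apply: lt_le_trans lt1 _; rewrite ler_pM2r ?gB_gt0 //.
  have := s_min _ _ hi_uv => /wo_le_eqVlt[->//|/g_anti]; exact: ltW.
Qed.

End LowerBound.

(** * Commuting probabilities of finite groups *)

Section FiniteGroups.
Import GroupScope.

Section CommutingPr.
Implicit Types gT : finGroupType.

Lemma commuting_pr_cent gT (G : {group gT}) :
  commuting_pr G = ((\sum_(x in G) #|'C_G[x]|)%N%:R / (#|G| ^ 2)%:R)%R.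
Proof.
rewrite /commuting_pr; congr (_%:R / _)%R.
rewrite -sum1_card (eq_bigl (fun p : gT * gT => (p.1 \in G) && (p.2 \in 'C_G[p.1]))).
  rewrite -(pair_big_dep (mem G) (fun x y => y \in 'C_G[x]) (fun _ _ => 1%N)) /=.
  by apply: eq_bigr => x _; rewrite sum1_card.
by move=> [x y] /=; rewrite [LHS]inE /= finset.in_setI cent1E (eq_sym (y * x)).
Qed.

Lemma sum_cent1 gT (G : {group gT}) :
  (\sum_(x in G) #|'C_G[x]| = #|classes G| * #|G|)%N.
Proof.
rewrite -sum_nat_const (partition_big (fun x => x ^: G) [in classes G]) /=;
  last by move=> x; apply: mem_classes.
apply: eq_bigr => _ /imsetP[x Gx ->].
rewrite -(Lagrange (subcent1_sub x G)) index_cent1 mulnC -sum_nat_const.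
apply: eq_big => [y|y /andP[_ /eqP yx]] /=.
  apply/andP/idP => [[Gy /eqP <-]|xy]; first exact: class_refl.
  by rewrite (class_eqP xy) (subsetP (class_subG Gx (subxx G))).
have /imsetP[z Gz ->] : y \in x ^: G by rewrite -yx class_refl.
by rewrite -{1}(conjGid Gz) cent1J -conjIg cardJg.
Qed.

Lemma commuting_prE gT (G : {group gT}) :
  commuting_pr G = (#|classes G|%:R / #|G|%:R)%R.
Proof.
rewrite commuting_pr_cent sum_cent1 natrM natrX expr2 invfM mulrA mulfK //.
by rewrite pnatr_eq0 -lt0n cardG_gt0.
Qed.

Lemma commuting_pr_gt0 gT (G : {group gT}) : (0 < commuting_pr G)%R.
Proof.
rewrite commuting_prE divr_gt0 ?ltr0n ?cardG_gt0 //.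
by apply/card_gt0P; exists [1]; apply: classes1.
Qed.

Lemma commuting_pr_setX (gT hT : finGroupType) (G : {group gT}) (H : {group hT}) :
  commuting_pr (setX_group G H) = (commuting_pr G * commuting_pr H)%R.
Proof.
rewrite !commuting_pr_cent mulrACA -!natrM -invfM -natrM; congr (_%:R / _%:R)%R.
  rewrite big_distrlr /= pair_big /=.
  rewrite (eq_bigl (fun p => (p.1 \in G) && (p.2 \in H))); last first.
    by move=> [x y]; rewrite inE.
  apply: eq_bigr => -[x y] _ /=; rewrite -cardsX; congr #|pred_of_set _|.
  apply/setP => -[x' y']; rewrite !in_setI !in_setX !in_setI !cent1E /=.
  rewrite -[(x', y') * _]/(x' * x, y' * y) -[(x, y) * _]/(x * x', y * y').
  by rewrite xpair_eqE andbACA.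
by rewrite cardsX expnMn.
Qed.

Lemma commuting_prs_mul x y :
  commuting_prs x -> commuting_prs y -> commuting_prs (x * y)%R.
Proof.
move=> [gT [G ->]] [hT [H ->]]; exists (gT * hT)%type, (setX_group G H).
by rewrite commuting_pr_setX.
Qed.

End CommutingPr.

(** * Characters and quotients by normal subgroups *)

Section NormalSubgroup.
Local Open Scope ring_scope.
Local Open Scope group_scope.
Variables (gT : finGroupType) (G H N : {group gT}).

Lemma card_classes_quotient : N <| G ->
  #|classes (G / N)| = #|[pred i : Iirr G | N \subset cfker 'chi_i]|.
Proof.
move=> nsNG; rewrite -(on_card_preimset (mod_Iirr_bij nsNG)) -NirrE -[LHS]card_ord.
by apply: eq_card => i; rewrite !inE mod_IirrE ?cfker_mod.
Qed.

Lemma card_classesD : N <| G ->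
  #|classes G| = (#|classes (G / N)|
                 + #|[pred i : Iirr G | ~~ (N \subset cfker 'chi_i)]|)%N.
Proof.
move=> nsNG; rewrite card_classes_quotient // -NirrE -[LHS]card_ord.
exact: esym (cardC [pred i : Iirr G | N \subset cfker 'chi_i]).
Qed.

(** By Frobenius reciprocity each constituent has degree at least that of ['chi_j], while the
    induced character has #|G : H| times that degree. *)
Lemma card_constt_Ind (j : Iirr H) : H \subset G ->
  (#|irr_constt ('Ind[G] 'chi_j)| <= #|G : H|)%N.
Proof.
move=> sHG; have Nind := cfInd_char G (irr_char j).
rewrite -(leC_nat) -(ler_pM2r (irr1_gt0 j)) -cfInd1 //.
rewrite [leRHS](_ : _ = (\sum_(i in irr_constt ('Ind[G] 'chi_j))
    '['Ind[G] 'chi_j, 'chi_i] * 'chi_i 1%g)%R); last first.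
  by rewrite {1}[('Ind[G] _)%CF]cfun_sum_constt sum_cfunE;
    apply: eq_bigr => i; rewrite cfunE.
rewrite mulr_natl -sumr_const; apply: ler_sum => i ij.
have ge1 : (1 <= '['Ind[G] 'chi_j, 'chi_i])%R.
  have /natrP[n nE] := Cnat_cfdot_char_irr i Nind.
  by move: ij; rewrite irr_consttE nE pnatr_eq0 ler1n lt0n.
apply: le_trans (ler_peMl (char1_ge0 (irr_char i)) ge1).
rewrite constt_Ind_Res in ij.
by have := char1_ge_constt (cfRes_char H (irr_char i)) ij; rewrite cfRes1.
Qed.

End NormalSubgroup.

Section QuotientBounds.
Local Open Scope ring_scope.
Local Open Scope group_scope.
Variables (gT : finGroupType) (G H N : {group gT}).
Hypotheses (nsHG : H <| G) (nsNG : N <| G) (sNH : N \subset H).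

(** Every irreducible character of G nontrivial on N is a constituent of one induced from an
    irreducible character of H nontrivial on N. *)
Lemma card_irr_nontrivial_on :
  (#|[pred i : Iirr G | ~~ (N \subset cfker 'chi_i)]|
   <= #|G : H| * #|[pred j : Iirr H | ~~ (N \subset cfker 'chi_j)]|)%N.
Proof.
have sHG := normal_sub nsHG.
have constt i : ~~ (N \subset cfker 'chi[G]_i) ->
    exists j, (~~ (N \subset cfker 'chi[H]_j)) && (i \in irr_constt ('Ind[G] 'chi_j)).
  move=> Ni; apply/existsP; apply: contraNT Ni; rewrite negb_exists => /forallP Nj.
  have: N \subset cfker ('Res[H] 'chi_i).
    rewrite cfkerE ?cfRes_char ?irr_char // subsetI sNH; apply/bigcapsP => j ij.
    by have := Nj j; rewrite constt_Ind_Res ij andbT negbK.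
  rewrite cfker_Res ?irr_char // subsetI => /andP[]//.
rewrite -sum1_card mulnC -sum_nat_const.
apply: (@leq_trans (\sum_(i | ~~ (N \subset cfker 'chi[G]_i))
    \sum_(j | ~~ (N \subset cfker 'chi[H]_j)) (i \in irr_constt ('Ind[G] 'chi_j))))%N.
  apply: leq_sum => i /constt[j /andP[Nj ij]].
  by rewrite (bigD1 j) //= ij.
rewrite exchange_big /=; apply: leq_sum => j _.
apply: leq_trans (card_constt_Ind j sHG).
rewrite -sum1_card [leqRHS]big_mkcond /= big_mkcond /=.
by apply: leq_sum => i _; case: ifP => // _; case: (i \in _).
Qed.

Lemma commuting_pr_quotient_le :
  (commuting_pr (G / N) / #|N|%:R <= commuting_pr G)%R.
Proof.
rewrite !commuting_prE card_quotient ?normal_norm // -mulrA -invfM -natrM.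
rewrite mulnC Lagrange ?normal_sub // ler_pM2r ?invr_gt0 ?ltr0n ?cardG_gt0 //.
by rewrite ler_nat [leqRHS](card_classesD nsNG) leq_addr.
Qed.

(** For a group K having N as a normal subgroup, Pr(K) - Pr(K/N)/|N| is the number of irreducible
    characters of K nontrivial on N, divided by |K|. *)
Lemma commuting_pr_quotient_ge :
  (commuting_pr G - commuting_pr (G / N) / #|N|%:R
   <= commuting_pr H - commuting_pr (H / N) / #|N|%:R)%R.
Proof.
have nsNH : N <| H := normalS sNH (normal_sub nsHG) nsNG.
have E (K : {group gT}) : N <| K ->
    (commuting_pr K - commuting_pr (K / N) / #|N|%:R =
    #|[pred i : Iirr K | ~~ (N \subset cfker 'chi_i)]|%:R / #|K|%:R)%R.
  move=> nsNK; rewrite !commuting_prE card_quotient ?normal_norm // -mulrA -invfM.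
  rewrite -natrM mulnC Lagrange ?normal_sub // -mulrBl; congr (_ / _)%R.
  by rewrite (card_classesD nsNK) natrD addrAC subrr add0r.
rewrite !E // ler_pdivrMr ?ltr0n ?cardG_gt0 // -(Lagrange (normal_sub nsHG)).
rewrite natrM mulrA divfK ?pnatr_eq0 -?lt0n ?cardG_gt0 // -natrM ler_nat mulnC.
exact: card_irr_nontrivial_on.
Qed.

End QuotientBounds.

(** * Commuting pairs modulo an abelian normal subgroup *)

Section AbelianNormal.
Variables (gT : finGroupType) (G H : {group gT}).
Hypotheses (nsHG : H <| G) (abH : abelian H).

Let pairs := [set p : gT * gT | [&& p.1 \in G, p.2 \in G & p.1 * p.2 == p.2 * p.1]].
Let fiber q := [set p in pairs | (H :* p.1, H :* p.2) == q].

(** Fix a commuting pair (g, g') in the fibre. As H is abelian, the pairs (h, h') for which hg and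
    h'g' commute form a subgroup [D] of H x H, and the fibre is a translate of [D]. *)
Lemma card_commuting_fiber q : fiber q = set0 \/ #|fiber q| %| #|H| ^ 2.
Proof.
have [->|/set0Pn[[g g']]] := eqVneq (fiber q) set0; first by left.
rewrite !inE /= => /andP[/and3P[Gg Gg' /eqP gg'] /eqP qE]; right.
have HJ x y : x \in H -> y \in G -> x ^ y^-1 \in H.
  by move=> Hx Gy; rewrite memJ_norm // groupV (subsetP (normal_norm nsHG)).
have HC x y : x \in H -> y \in H -> x * y = y * x.
  by move=> Hx Hy; apply: (centsP abH).
pose D := [set p in setX H H | p.1 * p.2 ^ g^-1 == p.2 * p.1 ^ g'^-1].
have gD : group_set D.
  apply/group_setP; split; first by rewrite !inE /= !group1 /= !conj1g eqxx.
  move=> [a b] [c d]; rewrite !inE /= => /andP[/andP[Ha Hb] /eqP ab].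
  move=> /andP[/andP[Hc Hd] /eqP cd]; rewrite !groupM //=.
  have swap (x y z w : gT) : y \in H -> z \in H -> x * y * (z * w) = x * z * (y * w).
    by move=> Hy Hz; rewrite !mulgA -(mulgA x y) (HC y z) // mulgA.
  by rewrite !conjMg swap ?HJ // ab cd swap ?HJ.
suff -> : fiber q = [set (p.1 * g, p.2 * g') | p in D].
  rewrite card_imset; last by move=> [a b] [c d] [/mulIg-> /mulIg->].
  have /cardSg : group gD \subset setX_group H H.
    by apply/subsetP => p; rewrite inE => /andP[].
  by rewrite cardsX.
have comm h h' : (h * g * (h' * g') == h' * g' * (h * g)) =
    (h * h' ^ g^-1 == h' * h ^ g'^-1).
  rewrite -[RHS](inj_eq (mulIg (g * g'))); congr (_ == _).
    by rewrite conjgE invgK !mulgA mulgKV.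
  by rewrite gg' conjgE invgK !mulgA mulgKV.
apply/setP => -[x y]; rewrite !inE /= -qE xpair_eqE.
apply/andP/imsetP => [[/and3P[Gx Gy xy] /andP[/eqP Hx /eqP Hy]]|].
  have Hxg : x * g^-1 \in H by rewrite -mem_rcoset -Hx rcoset_refl.
  have Hyg : y * g'^-1 \in H by rewrite -mem_rcoset -Hy rcoset_refl.
  exists (x * g^-1, y * g'^-1); rewrite /= ?mulgKV // !inE /= Hxg Hyg -comm.
  by rewrite !mulgKV.
move=> [[h h']]; rewrite !inE /= => /andP[/andP[Hh Hh'] hh'] [-> ->].
rewrite comm hh' !rcosetM (rcoset_id Hh) (rcoset_id Hh') !eqxx.
by rewrite !groupM // (subsetP (normal_sub nsHG)).
Qed.

(** Each of the #|G : H| ^ 2 pairs of cosets contributes #|fiber q| / #|H| ^ 2, which is 0 or a unit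
    fraction. *)
Lemma egyptian_commuting_pr :
  egyptian (#|G : H| ^ 2) ((#|G : H| ^ 2)%:R * commuting_pr G)%R.
Proof.
have -> : ((#|G : H| ^ 2)%:R * commuting_pr G =
    \sum_(q <- enum (setX (rcosets H G) (rcosets H G))) #|fiber q|%:R / (#|H| ^ 2)%:R)%R.
  rewrite /commuting_pr -(Lagrange (normal_sub nsHG)) expnMn natrM invfM.
  rewrite mulrCA [X in (_ * X)%R]mulrCA divff ?mulr1; last first.
    by rewrite pnatr_eq0 -lt0n expn_gt0 indexg_gt0.
  rewrite big_enum -mulr_suml -natr_sum; congr (_%:R / _)%R.
  transitivity #|pairs|; first by rewrite cardsE.
  rewrite -sum1_card (partition_big (fun p => (H :* p.1, H :* p.2))
    [in setX (rcosets H G) (rcosets H G)]) /=.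
    by apply: eq_bigr => q _; rewrite -sum1_card; apply: eq_bigl => p; rewrite [RHS]inE.
  move=> p; rewrite inE => /and3P[Gp Gp' _]; rewrite in_setX /=.
  by apply/andP; split; apply/rcosetsP; [exists p.1|exists p.2].
rewrite -[X in egyptian X _](_ : size (enum (setX (rcosets H G) (rcosets H G))) = _).
  apply: egyptian_sum => q; have [->|/dvdnP[n nE]] := card_commuting_fiber q.
    by left; rewrite cards0 mul0r.
  have H0 : #|H| ^ 2 > 0 by rewrite expn_gt0 cardG_gt0.
  move: (H0); rewrite nE; case: n nE => // n nE; rewrite muln_gt0 => /= f0.
  by right; exists n; rewrite natrM invfM mulrCA divff ?mulr1 // pnatr_eq0 -lt0n.
by rewrite -cardE cardsX.
Qed.
End AbelianNormal.

(** * Indices of intersections and cores *)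

Lemma leq_indexg (gT : finGroupType) (G K H : {group gT}) :
  K \subset G -> #|K : H| <= #|G : H|.
Proof. by move=> sKG; apply/subset_leq_card/imsetS. Qed.

Lemma index_bigcap (gT : finGroupType) (G : {group gT}) (I : finType)
    (A : {set I}) (F : I -> {group gT}) n :
  (forall i, i \in A -> #|G : F i| <= n) ->
  #|G : \bigcap_(i in A) F i| <= (n ^ #|A|)%N.
Proof.
move: {2}#|A| (erefl #|A|) => k; elim: k A => [|k IH] A.
  move/eqP; rewrite cards_eq0 => /eqP-> _; rewrite big_set0 cards0 expn0.
  by rewrite -indexgI setIT indexgg.
move=> Ak AF; have [a Aa] : exists a, a \in A by apply/set0Pn; rewrite -cards_eq0 Ak.
rewrite (big_setD1 a) //= -indexgI setIA.
pose B : {group gT} := [group of \bigcap_(i in A :\ a) F i].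
rewrite -[X in #|_ : _ :&: X|]/(gval B).
have IHB : #|G : B| <= (n ^ k)%N.
  have Dk : #|A :\ a| = k by move: Ak; rewrite (cardsD1 a) Aa => -[].
  by rewrite -Dk; apply: IH => // i /setD1P[_]; apply: AF.
rewrite -(@Lagrange_index _ G (G :&: F a) (G :&: F a :&: B)) ?subsetIl // Ak expnS.
apply: leq_mul; first by rewrite indexgI AF.
by rewrite indexgI (leq_trans _ IHB) // leq_indexg // subsetIl.
Qed.

(** The core is the intersection of the conjugates of H; there are at most #|G : H| of them, each of
    index #|G : H|. *)
Lemma index_gcore (gT : finGroupType) (G H : {group gT}) : H \subset G ->
  #|G : gcore H G| <= (#|G : H| ^ #|G : H|)%N.
Proof.
move=> sHG.
have -> : gcore H G = \bigcap_(A in H :^: G) <<A>>%G.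
  rewrite /gcore [RHS](_ : _ = \bigcap_(A in H :^: G) A); last first.
    by apply: eq_bigr => _ /imsetP[x _ ->]; rewrite /= genGid.
  apply/setP => y; apply/bigcapP/bigcapP => [yH _ /imsetP[x Gx ->]|yH x Gx].
    exact: yH.
  by apply: yH; apply: imset_f.
apply: leq_trans (@index_bigcap _ G _ (H :^: G) (fun A => <<A>>%G) #|G : H| _) _.
  by move=> _ /imsetP[x Gx ->]; rewrite /= genGid -{1}(conjGid Gx) indexJg.
rewrite leq_pexp2l // card_conjugates.
by rewrite dvdn_leq // indexgS // subsetI sHG normG.
Qed.

Lemma pigeonhole (T I : finType) (A : {set T}) (B : {set I}) (f : T -> I) :
  A != set0 -> {in A, forall x, f x \in B} ->
  exists2 i, i \in B & #|A| <= #|B| * #|[set x in A | f x == i]|.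
Proof.
move=> /set0Pn[a Aa] AB.
have [i Bi i_max] := @arg_maxnP _ (f a) [in B]
  (fun i => #|[set x in A | f x == i]|) (AB a Aa).
exists i => //; rewrite -sum1_card (partition_big f [in B]) // -sum_nat_const.
apply: leq_sum => j Bj; apply: leq_trans (i_max j Bj).
by rewrite -sum1_card leq_eqVlt; apply/orP; left; apply/eqP/eq_bigl => x; rewrite inE.
Qed.

(** * Groups of class at most two *)

Section ClassTwo.
Variables (gT : finGroupType) (H : {group gT}).
Hypothesis H'Z : H^`(1) \subset 'Z(H).

Let H'C x y z : x \in H -> y \in H -> z \in H -> [~ x, y] ^ z = [~ x, y].
Proof.
move=> Hx Hy Hz; apply/conjg_fixP/commgP.
have /centerP[_] : [~ x, y] \in 'Z(H) by rewrite (subsetP H'Z) // mem_commg.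
exact.
Qed.

(** As commutators are central, the elements [x, h] already form a subgroup, and the class of x is
    its coset by x. *)
Lemma card_class_commg x : x \in H -> #|x ^: H| = #|[~: [set x], H]|.
Proof.
move=> Hx; have gc : group_set (commg_set [set x] H).
  apply/group_setP; split.
    by apply/imset2P; exists x 1; rewrite ?inE ?commg1.
  move=> _ _ /imset2P[_ h /set1P-> Hh ->] /imset2P[_ k /set1P-> Hk ->].
  apply/imset2P; exists x (k * h); rewrite ?inE ?groupM //.
  by rewrite commgMJ H'C.
rewrite /commutator -[commg_set _ _]/(gval (group gc)) genGid /=.
have -> : x ^: H = x *: commg_set [set x] H.
  apply/setP => y; apply/imsetP/lcosetP => [[h Hh ->]|].
    exists [~ x, h]; last by rewrite commgEl mulKVg.
    by apply/imset2P; exists x h; rewrite ?inE.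
  move=> [_ /imset2P[_ h /set1P-> Hh ->] ->].
  by exists h; rewrite // commgEl mulKVg.
exact: card_lcoset.
Qed.

(* Elements [x] with [[x, H]] proper are the ones with small class, so a large
   commuting probability yields many of them sharing the same subgroup
   [[x, H]]. *)
Lemma class2_descent (e : rat) : (0 <= e)%R ->
  (#|H^`(1)%g|%:R^-1 + e < commuting_pr H)%R ->
  exists R : {group gT}, [/\ R \subset H, [~: R, R] \proper H^`(1)
    & (e * #|H : R|%:R <= (2 ^ #|H^`(1)%g|)%:R)%R].
Proof.
move=> e0 Pr_gt; pose sub x := [~: [set x], H].
pose bad := [set x in H | sub x != H^`(1)].
have sub_der x : x \in H -> sub x \subset H^`(1).
  by move=> Hx; apply: commgSS; rewrite // sub1set.
have H0 : (0 < #|H|%:R :> rat)%R by rewrite ltr0n cardG_gt0.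
(* In the sum of the centralizer orders, an element outside [bad] contributes |H| / |H'| and one in
   [bad] at most |H|. *)
have bad_large : (e * #|H|%:R < #|bad|%:R)%R.
  move: Pr_gt; rewrite commuting_pr_cent ltr_pdivlMr; last first.
    by rewrite ltr0n expn_gt0 cardG_gt0.
  have le_sum : ((\sum_(x in H) #|'C_H[x]|)%N%:R <=
      \sum_(x in H) (#|H|%:R / #|H^`(1)%g|%:R + #|H|%:R * (x \in bad)%:R) :> rat)%R.
    rewrite natr_sum; apply: ler_sum => x Hx.
    have -> : (#|'C_H[x]|%:R = #|H|%:R / #|sub x|%:R :> rat)%R.
      rewrite -card_class_commg // -index_cent1 -(Lagrange (subcent1_sub x H)).
      by rewrite natrM mulfK // pnatr_eq0 -lt0n indexg_gt0.
    rewrite inE Hx /=; case: eqP => [->|_]; first by rewrite mulr0 addr0.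
    rewrite mulr1 -[leLHS]add0r lerD ?divr_ge0 ?ler0n //.
    by rewrite ler_pdivrMr ?ltr0n ?cardG_gt0 // ler_peMr ?ler0n // ler1n cardG_gt0.
  move=> /lt_le_trans/(_ le_sum).
  rewrite big_split /= sumr_const -mulr_sumr -natr_sum.
  have -> : (\sum_(x in H) (x \in bad) = #|bad|)%N.
    rewrite -sum1_card big_mkcond [RHS]big_mkcond; apply: eq_bigr => x _.
    by rewrite inE; case: (x \in H) => //=; case: ifP.
  rewrite -[(_ *+ #|H|)%R]mulr_natr natrX; move: H0; set h := (_%:R)%R.
  set m := (_^-1)%R; set b := (#|bad|%:R)%R.
  move=> h0; have -> : ((m + e) * h ^+ 2 = h * m * h + h * (e * h))%R by ring.
  by rewrite ltrD2l ltr_pM2l.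
have bad0 : bad != set0.
  rewrite -card_gt0 -(ltr0n rat); apply: le_lt_trans bad_large.
  by rewrite mulr_ge0 // ltW.
have [|L] := @pigeonhole _ _ bad (powerset H^`(1)) sub bad0.
  by move=> x; rewrite inE => /andP[/sub_der Hx _]; rewrite powersetE.
rewrite card_powerset powersetE => sL large.
have [x0] : exists x, x \in [set x in bad | sub x == L].
  apply/set0Pn; apply: contraNneq bad0 => L0; rewrite -cards_eq0 -leqn0.
  by rewrite (leq_trans large) // L0 cards0 muln0.
rewrite !inE => /andP[/andP[Hx0 x0bad] /eqP x0L].
(* All x with [x, H] inside the common subgroup [L], which is [sub x0]: they form a group by
   bilinearity of commutators, and its derived subgroup lies in [L]. *)
pose R0 := [set x in H | [forall h in H, [~ x, h] \in sub x0]].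
have gR0 : group_set R0.
  apply/group_setP; split.
    by rewrite inE group1; apply/forall_inP => h _; rewrite comm1g group1.
  move=> x y; rewrite !inE => /andP[Hx /forall_inP xL] /andP[Hy /forall_inP yL].
  rewrite groupM //; apply/forall_inP => h Hh.
  by rewrite commMgJ H'C // groupM ?xL ?yL.
exists (group gR0); split.
- by apply/subsetP => x; rewrite inE => /andP[].
- have x0_proper : sub x0 \proper H^`(1) by rewrite properEneq x0bad sub_der.
  apply: sub_proper_trans x0_proper.
  rewrite gen_subG; apply/subsetP => _ /imset2P[x y xR yR ->].
  move: xR yR; rewrite !inE => /andP[_ /forall_inP xL] /andP[Hy _].
  exact: xL.
have RL : #|[set x in bad | sub x == L]| <= #|group gR0|.
  apply/subset_leq_card/subsetP => x; rewrite !inE => /andP[/andP[Hx _] /eqP xL].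
  rewrite Hx; apply/forall_inP => h Hh; rewrite x0L -xL mem_commg ?inE //.
have sRH : group gR0 \subset H by apply/subsetP => x; rewrite inE => /andP[].
have R1 : (0 < #|group gR0|%:R :> rat)%R by rewrite ltr0n cardG_gt0.
rewrite -(ler_pM2l R1) mulrCA -natrM Lagrange // -natrM mulnC.
apply: (le_trans (ltW bad_large)); rewrite ler_nat (leq_trans large) //.
by rewrite leq_mul2l RL orbT.
Qed.
End ClassTwo.

(** * Generation by a large symmetric subset *)

Section Generation.
Variables (gT : finGroupType) (G : {group gT}) (X : {set gT}).
Hypotheses (X1 : 1 \in X) (XV : forall x, x \in X -> x^-1 \in X) (sXG : X \subset G).

Let powS n : X ^+ n \subset X ^+ n.+1.
Proof. by rewrite expgSr; apply: mulg_subl. Qed.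

Let pow_le m n : m <= n -> X ^+ m \subset X ^+ n.
Proof.
move=> /subnK <-; elim: (n - m) => [|k IH]; first by rewrite add0n.
by rewrite addSn; apply: subset_trans IH (powS _).
Qed.

Let pow_gen n : X ^+ n \subset <<X>>.
Proof.
elim: n => [|n IH]; first by rewrite expg0 sub1G.
by rewrite expgSr mul_subG // subset_gen.
Qed.

(* If [X^(3i+3)] contains some [g] outside [X^(3i+2)], then [g X] is disjoint
   from [X^(3i+1)]. *)
Let pow_growth i : (exists2 j, j < i & X ^+ (3 * j).+3 \subset X ^+ (3 * j).+2)
  \/ i.+1 * #|X| <= #|X ^+ (3 * i).+1|.
Proof.
elim: i => [|i [[j ji Xj]|IH]]; first by right; rewrite mul1n muln0 expg1.
  by left; exists j => //; apply: ltnW.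
have [sub|/subsetPn[g gX gNX]] := boolP (X ^+ (3 * i).+3 \subset X ^+ (3 * i).+2).
  by left; exists i.
right; rewrite mulSn; apply: leq_trans (leq_add (leqnn _) IH) _.
rewrite -(card_lcoset X g) -cardsUI (_ : _ :&: _ = set0) ?cards0 ?addn0.
  apply: subset_leq_card; rewrite subUset mulnS pow_le; last by lia.
  rewrite !addSn add0n andbT [X ^+ (3 * i).+4]expgSr.
  by apply: mulSg; rewrite sub1set.
apply/eqP; rewrite -subset0; apply/subsetP => y; rewrite !inE => /andP[/lcosetP[x Xx ->] gx].
case/negP: gNX; rewrite -(mulgK x g) expgSr mem_mulg ?XV //.
Qed.

(** Growth up to step n would exceed |G|, so the powers of [X] stop growing at some 3j + 2 with j <
    n, and that power is a group. *)
Lemma gen_expg n : #|G| <= n * #|X| -> <<X>> \subset X ^+ (3 * n).+1.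
Proof.
move=> Gn; have [[j jn Xj]|] := pow_growth n; last first.
  move=> le; have := leq_trans le (subset_leq_card (subset_trans (pow_gen _) _)).
  move=> /(_ G); rewrite gen_subG => /(_ sXG) /leq_trans/(_ Gn).
  by rewrite leq_pmul2r ?ltnn //; apply/card_gt0P; exists 1.
set a := (3 * j).+2 in Xj *.
have stab m : X ^+ (a + m) \subset X ^+ a.
  elim: m => [|m IH]; first by rewrite addn0.
  by rewrite addnS expgSr (subset_trans (mulSg _ IH)) // -expgSr.
have ga : group_set (X ^+ a).
  apply/group_setP; split.
    by rewrite (subsetP (pow_le (leq0n a))) // expg0 set11.
  by move=> x y xa ya; apply: (subsetP (stab a)); rewrite expgD mem_mulg.
have san : X ^+ a \subset X ^+ (3 * n).+1 by apply: pow_le; rewrite /a; lia.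
apply: subset_trans san.
rewrite -[X ^+ a]/(gval (group ga)) gen_subG /=.
by rewrite -{1}(expg1 X) pow_le.
Qed.

End Generation.

Lemma leq_card_imset2 (T1 T2 T : finType) (f : T1 -> T2 -> T)
  (A : {set T1}) (B : {set T2}) : #|[set f x y | x in A, y in B]| <= #|A| * #|B|.
Proof. by rewrite curry_imset2X (leq_trans (leq_imset_card _ _)) // cardsX. Qed.

(** * Groups with bounded conjugacy classes *)

Section ClassSizes.
Variable gT : finGroupType.
Implicit Types (G E V : {group gT}) (X S : {set gT}).

Lemma card_classM G x y : #|(x * y) ^: G| <= #|x ^: G| * #|y ^: G|.
Proof.
apply: leq_trans (leq_card_imset2 mulg (x ^: G) (y ^: G)).
apply/subset_leq_card/subsetP => _ /imsetP[g Gg ->].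
by rewrite conjMg; apply: imset2_f; apply: imset_f.
Qed.

Lemma card_class_expg G X n r : (forall x, x \in X -> #|x ^: G| <= n) ->
  forall x, x \in X ^+ r -> #|x ^: G| <= (n ^ r)%N.
Proof.
move=> Xn; elim: r => [|r IH] x; first by rewrite expg0 => /set1P->; rewrite class1G cards1.
rewrite expgSr => /mulsgP[y z yr /Xn zX ->]; rewrite expnSr.
by apply: leq_trans (card_classM _ _ _) _; apply: leq_mul => //; apply: IH.
Qed.

Lemma card_gen_abelian S q : abelian <<S>> -> (forall w, w \in S -> #[w] <= q) ->
  #|<<S>>| <= (q ^ #|S|)%N.
Proof.
move: {2}#|S| (erefl #|S|) => k; elim: k S => [|k IH] S.
  by move/eqP; rewrite cards_eq0 => /eqP->; rewrite gen0 cards1 cards0.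
move=> Sk abS Sq; have [w Sw] : exists w, w \in S by apply/set0Pn; rewrite -cards_eq0 Sk.
have Dk : #|S :\ w| = k by move: Sk; rewrite (cardsD1 w) Sw => -[].
have sDS : <<S :\ w>> \subset <<S>> by apply: genS; apply: subD1set.
have sw : <[w]> \subset <<S>> by rewrite cycle_subG mem_gen.
have -> : <<S>> = <[w]> * <<S :\ w>>.
  rewrite -norm_joinEl; last by apply: cents_norm; apply: centSS abS.
  by rewrite joing_idl joing_idr /joing (setD1K Sw).
apply: (@leq_trans (#[w] * #|<<S :\ w>>|)); first by rewrite mul_cardG leq_pmulr.
rewrite Sk expnS leq_mul ?Sq // -Dk IH //; first exact: abelianS abS.
by move=> x /setD1P[_]; apply: Sq.
Qed.

(** Take a in E with a largest class, [B] a set of elements conjugating a to every member of that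
    class, and [W] the quotients of pairs of members. For V = C_E(B, W), commutators lie in [W],
    hence are centralized by V, and the index is bounded because centralizers have index at most
    c. *)
Lemma bounded_classes E c : (forall x, x \in E -> #|x ^: E| <= c) ->
  exists V : {group gT}, [/\ V \subset E, #|E : V| <= (c ^ (c + c * c))%N,
    V^`(1) \subset 'Z(V) & #|V^`(1)| <= ((c * c) ^ (c * c))%N].
Proof.
move=> Ec.
have [a Ea a_max] := @arg_maxnP _ 1 [in E] (fun x => #|x ^: E|) (group1 E).
have {}a_max x : x \in E -> #|x ^: E| <= #|a ^: E| by apply: a_max.
have /choice[f fP] (y : gT) : exists b, y \in a ^: E -> b \in E /\ a ^ b = y.
  by have [/imsetP[b Eb ->]|] := boolP (y \in a ^: E); [exists b|exists 1].
pose B := [set f y | y in a ^: E].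
pose W := [set y * z^-1 | y in a ^: E, z in a ^: E].
have sEE : a ^: E \subset E by apply: class_subG.
have Bc : #|B| <= c by apply: leq_trans (leq_imset_card _ _) (Ec a Ea).
have Wc : #|W| <= c * c.
  by apply: leq_trans (leq_card_imset2 _ _ _) _; apply: leq_mul; apply: Ec.
have sWE : W \subset E.
  apply/subsetP => _ /imset2P[y z ya za ->].
  by rewrite groupM ?groupV // (subsetP sEE).
have sBE : B \subset E by apply/subsetP => _ /imsetP[y ya ->]; case: (fP y ya).
(* As u commutes with [B], u times the class of a lies in the class of ua; maximality gives
   equality, so u^g a^g = u y for some y in the class of a. *)
have UW u g : u \in E -> u \in 'C(B) -> g \in E -> [~ u, g] \in W.
  move=> Eu uB Eg.
  have ua_class : u *: (a ^: E) = (u * a) ^: E.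
    apply/eqP; rewrite eqEcard card_lcoset a_max ?groupM // andbT.
    apply/subsetP => _ /lcosetP[y ya ->]; have [Ef <-] := fP y ya.
    apply/imsetP; exists (f y) => //; rewrite conjMg (_ : u ^ f y = u) //.
    by apply/conjg_fixP/commgP/(centP uB)/imset_f.
  have /lcosetP[y ya uy] : (u * a) ^ g \in u *: (a ^: E).
    by rewrite ua_class imset_f.
  apply/imset2P; exists y (a ^ g); rewrite ?imset_f //.
  by rewrite commgEl; apply: (mulgI u); rewrite mulKVg mulgA -uy conjMg mulgK.
have sVE : E :&: 'C(B :|: W) \subset E by apply: subsetIl.
exists (E :&: 'C(B :|: W))%G; split => //=.
- rewrite indexgI; have := @index_bigcap gT E gT (B :|: W) (fun x => 'C[x]%G) c.
  move=> /(_ _)/leq_trans; apply.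
    by move=> x xBW; rewrite -indexgI index_cent1 Ec // (subsetP _ _ xBW) // subUset sBE.
  case: c Ec Bc Wc => [|c] Ec Bc Wc; last first.
    by rewrite leq_pexp2l // (leq_trans (leq_card_setU _ _)) // leq_add.
  by have := Ec 1 (group1 E); rewrite class1G cards1.
all: set V := E :&: 'C(B :|: W).
all: have VE v : v \in V -> [/\ v \in E, v \in 'C(B) & v \in 'C(W)] by
  rewrite inE centU inE => /and3P[].
all: have sVW : commg_set V V \subset W by
  apply/subsetP => _ /imset2P[x y /VE[Ex xB _] /VE[Ey _ _] ->]; apply: UW.
all: have VCW : <<W>> \subset 'C(V) by
  rewrite gen_subG centsC; apply/subsetP => v /VE[].
- rewrite subsetI der_sub; apply: subset_trans VCW; exact: genS.
have abW : abelian [~: V, V].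
  have dC : [~: V, V] \subset 'C(V) by apply: subset_trans VCW; apply: genS.
  exact: subset_trans dC (centS (der_sub 1 (E :&: 'C(B :|: W))%G)).
(* All powers [x, y]^i = [x^i, y] lie in [W]. *)
have order_W w : w \in commg_set V V -> #[w] <= c * c.
  move=> /imset2P[x y Vx Vy ->]; apply: leq_trans Wc; apply: subset_leq_card.
  apply/subsetP => _ /cycleP[i ->].
  have xC : commute x [~ x, y].
    have [_ _ /centP xW] := VE x Vx; apply: xW; apply: (subsetP sVW).
    exact: imset2_f.
  rewrite -commXg //; apply: (subsetP sVW); apply: imset2_f => //.
  by rewrite (groupX i (_ : x \in (E :&: 'C(B :|: W))%G)).
apply: leq_trans (card_gen_abelian abW order_W) _.
have [cc0|cc0] := posnP (c * c).
  have := Ec 1 (group1 E); rewrite class1G cards1; move: cc0; case: (c) => //.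
by rewrite leq_pexp2l // (leq_trans (subset_leq_card sVW)).
Qed.

End ClassSizes.

(** * Neumann's theorem and the descent on the derived subgroup *)

Definition class2_bounded (gT : finGroupType) (G H : {group gT}) (m d : nat) :=
  [/\ H <| G, H^`(1) \subset 'Z(H), #|G : H| <= m & #|H^`(1)| <= d].

Definition class2_prs (m d : nat) (x : rat) :=
  exists (gT : finGroupType) (G H : {group gT}),
    class2_bounded G H m d /\ x = commuting_pr G.

Lemma sub_der_center (gT : finGroupType) (V H : {group gT}) : H \subset V ->
  V^`(1) \subset 'Z(V) -> H^`(1) \subset 'Z(H).
Proof.
move=> sHV /subset_trans/(_ (subsetIr _ _)) V'C; rewrite subsetI der_sub.
by apply: subset_trans (dergS 1 sHV) (subset_trans V'C (centS sHV)).
Qed.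

Lemma commuting_pr_class_sum (gT : finGroupType) (G : {group gT}) :
  (commuting_pr G * #|G|%:R = \sum_(x in G) #|x ^: G|%:R^-1)%R.
Proof.
have G0 : (#|G|%:R != 0 :> rat)%R by rewrite pnatr_eq0 -lt0n cardG_gt0.
rewrite commuting_pr_cent natrX expr2 invfM mulrA mulfVK // natr_sum mulr_suml.
apply: eq_bigr => x Gx; rewrite -index_cent1 -(Lagrange (subcent1_sub x G)) natrM.
by rewrite invfM mulrA divff ?mul1r // pnatr_eq0 -lt0n cardG_gt0.
Qed.

(** For n >= 2/e, at least |G|/n elements have a class of size at most n. The subgroup they generate
    has bounded index and, by [gen_expg], bounded classes. *)
Lemma neumann (e : rat) : (0 < e)%R -> exists m d, forall x,
  commuting_prs x -> (e <= x)%R -> class2_prs m d x.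
Proof.
move=> e0; pose n := (Num.truncn (2%:R / e)).+1.
have en : (2%:R / n%:R <= e)%R.
  rewrite ler_pdivrMr ?ltr0Sn // -ler_pdivrMl // mulrC ltW //.
  exact: truncnS_gt.
(* [c] bounds the classes inside <<X>>, [M] the index of the subgroup given by [bounded_classes],
   and M^M that of its core. *)
pose c := (n ^ (3 * n).+1)%N; pose M := (n * c ^ (c + c * c))%N.
exists (M ^ M)%N, ((c * c) ^ (c * c))%N => x [gT [G ->]] eG.
pose X := [set x in G | #|x ^: G| <= n].
have sXG : X \subset G by apply/subsetP => y; rewrite inE => /andP[].
have X1 : 1 \in X by rewrite inE group1 class1G cards1.
have XV y : y \in X -> y^-1 \in X.
  rewrite !inE groupV => /andP[-> /=]; rewrite -!index_cent1.
  by rewrite -!cent_cycle cycleV.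
have large : #|G| <= n * #|X|.
  have : (e * #|G|%:R <= \sum_(y in G) ((y \in X)%:R + n%:R^-1) :> rat)%R.
    apply: (@le_trans _ _ (commuting_pr G * #|G|%:R)%R).
      by rewrite ler_wpM2r ?ler0n.
    rewrite commuting_pr_class_sum; apply: ler_sum => y Gy; rewrite inE Gy /=.
    have y0 : 0 < #|y ^: G| by apply/card_gt0P; exists y; apply: class_refl.
    case: leqP => ny.
      rewrite -[leLHS]addr0 lerD ?invr_ge0 ?ler0n // invf_le1 ?ltr0n //.
      by rewrite ler1n.
    by rewrite add0r lef_pV2 ?posrE ?ltr0n // ler_nat ltnW.
  rewrite big_split /= sumr_const -natr_sum.
  have -> : (\sum_(y in G) (y \in X) = #|X|)%N.
    rewrite -sum1_card big_mkcond [RHS]big_mkcond; apply: eq_bigr => y _.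
    by rewrite inE; case: (y \in G) => //=; case: ifP.
  rewrite -(ler_nat rat) natrM -[(n%:R^-1 *+ #|G|)%R]mulr_natr.
  have n0 : (0 < n%:R :> rat)%R by rewrite ltr0Sn.
  have /(ler_wpM2r (ler0n rat #|G|)) := en.
  move: #|G|%:R%R #|X|%:R%R => g b le1 le2.
  rewrite -ler_pdivrMl //; move: le1 le2; set ni := (n%:R^-1)%R.
  by lra.
have EX := gen_expg X1 XV sXG large.
have sEG : <<X>> \subset G by rewrite gen_subG.
have Ec y : y \in <<X>>%G -> #|y ^: <<X>>%G| <= c.
  move=> /(subsetP EX) yX; apply: leq_trans (subset_leq_card (imsetS _ sEG)) _.
  by apply: card_class_expg yX => z; rewrite inE => /andP[].
have [V [sVE EV V'Z V'c]] := bounded_classes Ec.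
have sVG : V \subset G := subset_trans sVE sEG.
have GV : #|G : V| <= M.
  rewrite -(Lagrange_index sEG sVE) leq_mul //.
  rewrite -(@leq_pmul2r #|<<X>>|) ?cardG_gt0 // mulnC Lagrange //.
  by rewrite (leq_trans large) // leq_mul2l subset_leq_card ?orbT // subset_gen.
have sHV := gcore_sub V G.
exists gT, G, (gcore_group V G); split=> //; split.
- exact: gcore_normal.
- exact: sub_der_center sHV V'Z.
- apply: leq_trans (index_gcore sVG) _.
  apply: (@leq_trans (M ^ #|G : V|)); first by rewrite leq_exp2r ?indexg_gt0.
  by rewrite leq_pexp2l // (leq_trans _ GV) ?indexg_gt0.
- by apply: leq_trans V'c; apply/subset_leq_card/dergS.
Qed.

(** Since H/H' is abelian, [commuting_pr_quotient_ge] turns the excess of Pr(G) into Pr(H) > 1/|H'|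
    + e. The core in G of the subgroup from [class2_descent] replaces H. *)
Lemma class2_prs_step (m d : nat) (e : rat) : (0 < e)%R -> exists m',
  forall (gT : finGroupType) (G H : {group gT}),
  H <| G -> H^`(1) \subset 'Z(H) -> #|G : H| <= m -> #|H^`(1)| = d.+1 ->
  (commuting_pr (G / H^`(1))%g / d.+1%:R + e < commuting_pr G)%R ->
  class2_prs m' d (commuting_pr G).
Proof.
move=> e0; pose k := Num.truncn ((2 ^ d.+1)%:R / e : rat).
pose M := (m * k)%N; exists (M ^ M)%N => gT G H nsHG H'Z GH H'd Pr_gt.
have sHG := normal_sub nsHG.
have nsH'G : H^`(1) <| G := char_normal_trans (der_char 1 H) nsHG.
have abq : abelian (H / H^`(1)) := der_abelian 0 H.
have Pr_H : (#|H^`(1)%g|%:R^-1 + e < commuting_pr H)%R.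
  have := commuting_pr_quotient_ge nsHG nsH'G (der_sub 1 H).
  rewrite [commuting_pr (H / _)]commuting_prE.
  move: abq; rewrite card_classes_abelian => /eqP ->.
  rewrite divff ?mul1r; last by rewrite pnatr_eq0 -lt0n cardG_gt0.
  move: Pr_gt; rewrite -H'd; lra.
have [R [sRH R'H' Rk]] := class2_descent H'Z (ltW e0) Pr_H.
have sRG := subset_trans sRH sHG.
have HR : #|H : R| <= k.
  rewrite truncn_ge_nat; last by rewrite divr_ge0 ?ler0n // ltW.
  by rewrite ler_pdivlMr // mulrC -H'd.
have GR : #|G : R| <= M by rewrite -(Lagrange_index sHG sRH) leq_mul.
have sCR := gcore_sub R G.
exists gT, G, (gcore_group R G); split=> //; split.
- exact: gcore_normal.
- exact: sub_der_center (subset_trans sCR sRH) H'Z.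
- apply: leq_trans (index_gcore sRG) _.
  apply: (@leq_trans (M ^ #|G : R|)); first by rewrite leq_exp2r ?indexg_gt0.
  by rewrite leq_pexp2l // (leq_trans _ GR) ?indexg_gt0.
- rewrite -ltnS -H'd; apply: leq_ltn_trans (proper_card R'H').
  exact/subset_leq_card/(dergS 1 sCR).
Qed.

(** The derived subgroup is the centre, of order 2, so noncentral classes have size 2. *)
Lemma extraspecial2_commuting_pr (gT : finGroupType) (G : {group gT}) :
  2.-group G -> extraspecial G -> (commuting_pr G = 2%:R^-1 + #|G|%:R^-1)%R.
Proof.
move=> pG [[_ G'Z] prZ].
have Z2 : #|'Z(G)| = 2.
  have /pgroupP/(_ _ prZ (dvdnn _)) := pgroupS (center_sub G) pG.
  by rewrite inE => /eqP.
have G0 : (#|G|%:R != 0 :> rat)%R by rewrite pnatr_eq0 -lt0n cardG_gt0.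
apply: (mulIf G0); rewrite commuting_pr_class_sum mulrDl mulVf //.
have clE x : x \in G -> (#|x ^: G|%:R^-1 = 2%:R^-1 + 2%:R^-1 * (x \in 'Z(G))%:R :> rat)%R.
  move=> Gx; rewrite card_class_commg ?G'Z // inE Gx /=.
  have : #|[~: [set x], G]| %| 2.
    by rewrite -Z2 -G'Z cardSg // commgSS // sub1set.
  rewrite -sub1set => d2.
  have [/commG1P->|] := boolP ([set x] \subset 'C(G)); first by rewrite cards1; apply/eqP.
  move=> /commG1P/eqP; rewrite trivg_card1 => n1.
  by rewrite (eqP (_ : #|_| == 2)) ?mulr0 ?addr0 //; apply/eqP/prime_nt_dvdP.
rewrite (eq_bigr _ clE) big_split /= sumr_const -mulr_sumr -natr_sum.
congr (_ + _)%R; first by rewrite mulr_natr.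
have -> : (\sum_(y in G) (y \in 'Z(G)) = #|'Z(G)|)%N.
  rewrite -sum1_card big_mkcond [RHS]big_mkcond; apply: eq_bigr => y _.
  have := subsetP (center_sub G) y.
  by case: (y \in 'Z(G)) => [->//|_]; case: ifP.
by rewrite Z2 mulVf.
Qed.

Lemma decreasing_commuting_prs : exists f : nat -> rat,
  (forall n, commuting_prs (f n) /\ (2%:R^-1 <= f n)%R) /\
  (forall i j, (i < j)%N -> (f j < f i)%R).
Proof.
(* The shift to n + 1 skips the group of order 2, which is not extraspecial. *)
exists (fun n => 2%:R^-1 + (2 ^ n.+1.*2.+1)%:R^-1)%R; split=> [n|i j ij].
  split; last by rewrite lerDl invr_ge0 ler0n.
  exists _, (2^{1+2*n.+1})%G; rewrite -(@card_pX1p2n 2 n.+1) //.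
  apply/esym/extraspecial2_commuting_pr; first exact: pX1p2n_pgroup.
  exact: pX1p2n_extraspecial.
rewrite ltrD2l ltf_pV2 ?posrE ?ltr0n ?expn_gt0 // ltr_nat ltn_exp2l //.
by rewrite ltnS ltn_double ltnS.
Qed.

End FiniteGroups.

(** * The order type *)

Section Exponents.

Definition omega2 : woType := omega_pow (wo_fin 2).

(* The ordinal [omega * i + j]. *)
Definition key (i j : nat) : omega2 :=
  [fsfun c in [fset ord0; ord_max]%fset => if c == ord0 :> 'I_2 then j else i].

Lemma I2P (c : 'I_2) : c = ord0 \/ c = ord_max.
Proof. by case: c => [[|[|]]] // p; [left|right]; apply: val_inj. Qed.

Lemma keyE i j (c : 'I_2) :
  (key i j : code (wo_fin 2)) c = if c == ord0 then j else i.
Proof. by rewrite fsfun_fun in_fset2; case: (I2P c) => ->. Qed.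

Lemma key_ltl i j i' j' : i < i' -> wo_lt (key i j) (key i' j').
Proof.
move=> ii'; apply/omega_powE; exists (ord_max : 'I_2); rewrite !keyE; split=> // c.
by case: (I2P c) => ->.
Qed.

Lemma key_ltr i j j' : j < j' -> wo_lt (key i j) (key i j').
Proof.
move=> jj'; apply/omega_powE; exists (ord0 : 'I_2); rewrite !keyE; split=> // c.
by rewrite !keyE; case: (I2P c) => ->; rewrite ?wo_ltxx.
Qed.

Lemma keyP (c : omega2) : exists i j, c = key i j.
Proof.
exists ((c : code (wo_fin 2)) (ord_max : 'I_2)), ((c : code (wo_fin 2)) (ord0 : 'I_2)).
apply/fsfunP => d; rewrite keyE.
by case: (I2P d) => ->.
Qed.

Lemma key_lt_inv i j i' j' : wo_lt (key i j) (key i' j') ->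
  i < i' \/ i = i' /\ j < j'.
Proof.
move=> lt; have no (x y : omega2) : wo_lt x y -> wo_lt y x -> False.
  by move=> xy /(wo_lt_trans xy); rewrite wo_ltxx.
case: (ltngtP i i') => ii'; [by left|by have := no _ _ lt (key_ltl _ _ ii')|].
right; split=> //; rewrite ii' in lt.
case: (ltngtP j j') => // jj'; first by have := no _ _ lt (key_ltr _ jj').
by rewrite jj' wo_ltxx in lt.
Qed.

End Exponents.

(** * Upper bound for the commuting probabilities *)

Section UpperBound.
Local Open Scope ring_scope.

Lemma ot_le_shift (K K' : woType) (s : K -> K') (e : K) (e' : K') S :
  (forall c d, wo_lt c d -> wo_lt (s c) (s d)) ->
  (forall c, wo_le e' (s c) -> wo_le e c) -> ot_le e S -> ot_le e' S.
Proof.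
move=> s_mono se [f [f_below f_anti]]; have [t [ts t0 t_lt]] := code_shift s_mono.
exists (t \o f); split=> [x Sx d e'd /=|x y Sx Sy yx].
  have [[c dE]|dN] := pselect (exists c, d = s c); last first.
    by rewrite t0 // => c dc; apply: dN; exists c.
  by rewrite dE ts f_below //; apply: se; rewrite -dE.
by apply: t_lt; apply: f_anti.
Qed.

Lemma wo_omega_ltE (i j : nat) : @wo_lt wo_omega i j = (i < j)%N.
Proof. by rewrite /wo_lt /= ltn_neqAle. Qed.

(** Contains Pr(G/H')/|H'| whenever |H'| = k + 1 and |G : H| = t + 1 <= m. *)
Definition quotient_prs (m k : nat) (q : rat) := exists2 t : nat, (t < m.+1)%N &
  egyptian (t.+1 ^ 2) ((t.+1 ^ 2 * k.+1)%N%:R * q).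

Lemma quotient_prs_ot_le m k : exists e : nat, @ot_le wo_omega e (quotient_prs m k).
Proof.
pose S t q := egyptian (t.+1 ^ 2) ((t.+1 ^ 2 * k.+1)%N%:R * q).
have /choice[f fP] t : exists e : nat, @ot_le wo_omega e (S t).
  have [e eP] := egyptian_ot_le (t.+1 ^ 2); exists e.
  apply: (@ot_le_preimage wo_omega e _ _ _ eP) => x y xy.
  by rewrite ltr_pM2l // ltr0n muln_gt0 expn_gt0.
pose e := (\sum_(t < m.+1) f t)%N; exists e.+1.
apply: (@ot_le_bigcup wo_omega e e.+1 m.+1 S); first by rewrite wo_omega_ltE.
move=> t tm; apply: ot_le_sub (fP t) => //=.
by rewrite /e (bigD1 (Ordinal tm)) //= leq_addr.
Qed.

(** Induction on d. A new value x lies above Pr(G/H')/|H'|, an element of [Q]; if it exceeds the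
    largest element [p x] of [Q] below it by a fixed e, [class2_prs_step] lowers the bound on |H'|.
    So [ot_le_above] applies. *)
Lemma class2_prs_ot_le d m : ot_le (key d 0) (class2_prs m d).
Proof.
elim: d m => [|k IH] m.
  apply: ot_le_sub (wo_refl _) _ (ot_le_set1 _ 0) => x [gT [G [H [[_ _ _]]]]].
  by rewrite leqNgt cardG_gt0.
pose Q := quotient_prs m k; have [eQ QeQ] := quotient_prs_ot_le m k.
(* Ensures that every x >= 0 has an element of [Q] at or below it. *)
have Q0 : Q 0.
  exists 0%N => //; rewrite mulr0.
  by exists 0; [|left].
have Q_rwo := ot_le_rwo QeQ.
have /choice[p pP] (x : rat) : exists p, 0 <= x ->
    [/\ Q p, p <= x & forall q, Q q -> q <= x -> q <= p].
  have [x0|] := leP 0 x; last by exists 0.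
  by have [|p pP] := Q_rwo (fun q => q <= x); [exists 0|exists p].
pose S1 x := [/\ class2_prs m k.+1 x, ~ class2_prs m k x & ~ Q x].
have S1_ge0 x : S1 x -> 0 <= x.
  by move=> [[gT [G [H [_ ->]]]] _ _]; rewrite ltW ?commuting_pr_gt0.
have Q_key : ot_le (key k eQ.+1) Q.
  apply: (@ot_le_shift wo_omega _ (key k) (eQ : wo_omega)) QeQ.
    by move=> i j; rewrite wo_omega_ltE; apply: key_ltr.
  move=> j le; rewrite /= leqNgt; apply/negP => jeQ.
  by move: le; rewrite wo_leNlt key_ltr // ltnW.
have S1_key : ot_le (key k eQ.+1) S1.
  have [fQ [fQ_below fQ_anti]] := QeQ.
  (* [Q] is encoded at the exponents omega k + j + 1; the exponent omega k stays free for the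
     integer parts in [ot_le_above]. *)
  have key_mono i j : @wo_lt wo_omega i j -> wo_lt (key k i.+1) (key k j.+1).
    by rewrite wo_omega_ltE => ij; apply: key_ltr.
  have [t [ts t0 t_lt]] := @code_shift wo_omega omega2 (fun j => key k j.+1) key_mono.
  apply: (@ot_le_above _ (key k 0) _ S1 Q p (fun q => t (fQ q))).
  - exact: key_ltr.
  - move=> x S1x; have [Qp px p_max] := pP x (S1_ge0 x S1x).
    have px' : p x < x.
      by rewrite lt_neqAle px andbT; apply/eqP => pxE; case: S1x => _ _; rewrite -{1}pxE.
    split=> // y S1y yx; have [Qpy pyy _] := pP y (S1_ge0 y S1y).
    by apply: p_max => //; apply: le_trans pyy (ltW yx).
  - move=> q c _ ck; apply: t0 => j cE; move: ck; rewrite cE wo_leNlt.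
    by rewrite key_ltr.
  - move=> q Qq c ec; have [[j cE]|cN] := pselect (exists j, c = key k j.+1); last first.
      by apply: t0 => j cE; apply: cN; exists j.
    rewrite cE ts; apply: fQ_below => //=; rewrite leqNgt; apply/negP => jeQ.
    by move: ec; rewrite cE wo_leNlt key_ltr.
  - by move=> q r Qq Qr rq; apply/t_lt/fQ_anti.
  - move=> e e0; have [m' m'P] := class2_prs_step m k e0.
    apply: ot_le_sub (wo_refl _) _ (IH m') => x [S1x px].
    have x0 := S1_ge0 x S1x; case: S1x => -[gT [G [H [[nsHG H'Z GH H'k] xE]]]] Nk NQ.
    have H'd : #|(H^`(1))%g| = k.+1.
      apply/eqP; rewrite eqn_leq H'k ltnNge; apply/negP => H'le.
      by apply: Nk; exists gT, G, H.
    rewrite xE; apply: (m'P _ _ H) => //; rewrite -xE; apply: le_lt_trans px.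
    rewrite lerD2r; have [_ _] := pP x x0; apply.
      have nsH'G : (H^`(1) <| G)%g := char_normal_trans (der_char 1 H) nsHG.
      have := egyptian_commuting_pr (quotient_normal (H^`(1))%G nsHG) (der_abelian 0 H).
      rewrite index_quotient_eq;
        [|by rewrite subIset // der_sub orbT|exact: normal_sub|exact: normal_norm].
      case GHE: #|G : H|%g (indexg_gt0 G H) => [//|t1] _ Et; exists t1.
        by rewrite ltnS -ltnS -GHE; apply: leqW.
      by rewrite natrM -mulrA [X in _ * X]mulrC divfK ?pnatr_eq0.
    rewrite xE -H'd; apply: commuting_pr_quotient_le.
    exact: char_normal_trans (der_char 1 H) nsHG.
apply: (@ot_le_sub _ (key k eQ.+3) _ (fun x => class2_prs m k x \/ (Q x \/ S1 x))).
- exact/wo_ltW/key_ltl.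
- move=> x Sx; have [|Nx] := pselect (class2_prs m k x); first by left.
  by right; have [|NQ] := pselect (Q x); [left|right].
have keyS j : wo_lt (key k j) (key k j.+1) by apply: key_ltr.
apply: ot_le_setU (keyS eQ.+2) _ (ot_le_setU (keyS eQ.+1) Q_key S1_key).
by apply: ot_le_sub (IH m) => //; apply/wo_ltW/key_ltr.
Qed.

Lemma commuting_prs_ot_le (e : rat) : 0 < e ->
  exists d : nat, ot_le (key d 0) (fun x => commuting_prs x /\ e <= x).
Proof.
move=> e0; have [m [d mdP]] := neumann e0; exists d.
by apply: ot_le_sub (wo_refl _) _ (class2_prs_ot_le d m) => x [Px ex]; apply: mdP.
Qed.

Lemma commuting_prs_gt0 x : commuting_prs x -> 0 < x.
Proof. by move=> [gT [G ->]]; apply: commuting_pr_gt0. Qed.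

Lemma commuting_prs_rwo : reverse_well_ordered commuting_prs.
Proof.
move=> P [a Pra Pa]; have [d /ot_le_rwo rwo] := commuting_prs_ot_le (commuting_prs_gt0 Pra).
have [|x [[Prx ax] Px x_max]] := rwo P; first by exists a.
exists x; split=> // y Pry Py; have [ay|/ltW ya] := leP a y; first exact: x_max.
exact: le_trans ya ax.
Qed.

End UpperBound.

(** * The two candidate order types *)

Section Final.
Local Open Scope ring_scope.

(** Otherwise omega^(omega^2) embeds above some x > 0, where the type is at most omega^(omega d);
    its element omega^(omega d) would then be mapped strictly below itself. *)
Lemma commuting_prs_antitone :
  exists f : rat -> omega_pow omega2, antitone_on commuting_prs f.
Proof.
have [[f [f_anti _]]|] :=
  @wo_comparison (omega_pow omega2) _ [fsfun] commuting_prs_rwo.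
  by exists f.
move=> [x [g [Px gP g_anti]]]; exfalso.
have [d [f [f_below f_anti]]] := commuting_prs_ot_le (commuting_prs_gt0 Px).
have gS w : commuting_prs (g w) /\ x <= g w by have [] := gP w; split=> //; apply: ltW.
pose w0 : omega_pow omega2 := code_unit (key d 0) 1.
have : wo_le w0 ((f \o g : omega_pow omega2 -> omega_pow omega2) w0).
  apply: (@wo_expansive _ (fun=> True)) => // v w _ _ vw /=.
  by apply/omega_powE/f_anti => //; apply: g_anti.
by rewrite wo_leNlt; apply/negP/negPn/omega_powE/below_lt_unit/f_below/gS.
Qed.

Lemma below_down (K : woType) (e : K) (u v : code K) :
  below e v -> omega_pow_lt u v -> below e u.
Proof.
move=> ve [b [ub uE]] c ec; rewrite uE ?ve //.
rewrite wo_ltNle; apply/negP => cb; move: ub; rewrite ve //.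
exact: wo_le_trans ec cb.
Qed.

Lemma ot_ge_has_order_type (K : woType) (e : nat -> K)
    (f : rat -> omega_pow K) : antitone_on commuting_prs f ->
  (forall k, ot_ge commuting_prs (e k)) ->
  (forall u : code K, exists k, below (e k) u) ->
  has_order_type commuting_prs (fun x y : rat => y <= x) (omega_pow K).
Proof.
move=> f_anti ge cover; apply: (antitone_has_order_type _ _ f_anti).
- exact: ([fsfun] : code K).
- exact: commuting_prs_rwo.
move=> w0; have [k w0k] := cover w0; have [g [x [_ gP g_anti]]] := ge k.
exists (below (e k)), g; split=> // [v w wk /omega_powE|w /gP[]//|v w vk wk /omega_powE].
  exact: below_down.
exact: g_anti.
Qed.

(** Only the zero code is below the least exponent, so one probability suffices. *)
Lemma ot_ge_bottom (K : woType) (e : K) : (forall c, wo_le e c) -> ot_ge commuting_prs e.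
Proof.
move=> e0; have [f [fP _]] := decreasing_commuting_prs.
exists (fun=> f 0%N), (2%:R^-1); split=> // u v ue ve [b].
by rewrite (ue b) ?(ve b) // => -[].
Qed.

(** Each multiplication by the extraspecial sequence, of type omega, raises the exponent by one; the
    top part of a code is its coefficient at k. *)
Lemma ot_ge_omega (k : nat) : @ot_ge commuting_prs wo_omega k.
Proof.
elim: k => [|k IH]; first exact: ot_ge_bottom.
have [f [fP f_anti]] := decreasing_commuting_prs.
apply: (@ot_ge_mul _ commuting_prs_mul wo_omega wo_omega k k.+1
  (fun u => u k) S f 2%:R^-1) IH => //.
- by move=> a; rewrite wo_omega_ltE.
- by move=> a b; rewrite wo_omega_ltE.
- by move=> a b; rewrite wo_omega_ltE; apply: f_anti.
- move=> u v uk vk [b [ub uE]]; have bk : (b <= k)%N.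
    by rewrite leqNgt; apply/negP => kb; rewrite (vk b) ?ltn0 // in ub.
  rewrite wo_omega_ltE; move: bk; rewrite leq_eqVlt => /predU1P[<-|bk]; first by right.
  by left=> c kc; apply: uE; rewrite wo_omega_ltE (leq_trans bk).
- by move=> u v _ _; apply; apply: wo_refl.
Qed.

Lemma fset_bounded (T : choiceType) (X : {fset T}) (F : T -> nat) :
  exists k, forall c, c \in X -> (F c < k)%N.
Proof.
exists (\max_(c <- X) F c).+1 => c cX; rewrite ltnS.
by have := @leq_bigmax_seq T (enum_fset X) predT F c cX; apply.
Qed.

Lemma omega_below_cover (u : code wo_omega) : exists k : nat, @below wo_omega k u.
Proof.
have [k kP] := fset_bounded (finsupp u) (fun c : wo_omega => c : nat).
exists k => c /= kc; apply/eqP; rewrite -memNfinsupp.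
by apply: contraTN kc => /kP; rewrite -ltnNge.
Qed.

Lemma omega_code_succ :
  let s a := code_add a (code_unit (0%N : wo_omega) 1) in
  (forall a, @wo_lt (omega_pow wo_omega) a (s a)) /\
  (forall a b, @wo_lt (omega_pow wo_omega) a b -> @wo_le (omega_pow wo_omega) (s a) b).
Proof.
split=> [a|a b /omega_powE[c [ac aE]]].
  apply/omega_powE; exists 0%N; rewrite code_addE code_unitE eqxx addn1 ltnSn.
  by split=> // d; rewrite wo_omega_ltE code_addE code_unitE;
    case: d => // d _; rewrite addn0.
apply/code_leE.
have unit0 (d : nat) : (0 < d)%N -> code_unit (0%N : wo_omega) 1 d = 0%N.
  by rewrite code_unitE; case: d.
have [c0|c0] := posnP c; last first.
  right; exists c; rewrite code_addE unit0 // addn0; split=> // d cd.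
  rewrite code_addE unit0 ?addn0 ?aE //.
  by move: cd; rewrite wo_omega_ltE; apply: leq_ltn_trans.
rewrite {}c0 in ac aE.
have sE d : (0 < d)%N -> code_add a (code_unit (0%N : wo_omega) 1) d = b d.
  by move=> d0; rewrite code_addE unit0 // addn0 aE // wo_omega_ltE.
have s0 : code_add a (code_unit (0%N : wo_omega) 1) 0%N = (a 0%N).+1.
  by rewrite code_addE code_unitE eqxx addn1.
move: ac; rewrite leq_eqVlt => /predU1P[ab|ab].
  left; apply/fsfunP => -[|d]; last exact: sE.
  by rewrite s0.
by right; exists 0%N; rewrite s0; split=> // d; rewrite wo_omega_ltE; apply: sE.
Qed.

Lemma code_row_exists (k : nat) (u : code omega2) :
  exists v : code wo_omega, forall j : nat, v j = u (key k j).
Proof.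
exists [fsfun j in [fset (c : code (wo_fin 2)) (ord0 : 'I_2) | c in finsupp u]%fset =>
  u (key k j)].
move=> j; rewrite fsfun_fun; case: imfsetP => // Nj.
apply/esym/eqP; rewrite -memNfinsupp; apply/negP => uj; apply: Nj.
by exists (key k j); rewrite ?keyE.
Qed.

(** Each multiplication by the copy [g] of omega^omega adds omega to the exponent. The top part of a
    code is its row of coefficients at the exponents omega k + j, itself a code of an ordinal below
    omega^omega. *)
Lemma ot_ge_omega2 x (g : omega_pow wo_omega -> rat) (k : nat) : 0 < x ->
  (forall u, commuting_prs (g u) /\ x < g u) ->
  (forall u v, @wo_lt (omega_pow wo_omega) u v -> g v < g u) ->
  ot_ge commuting_prs (key k 0).
Proof.
move=> x0 gP g_anti; elim: k => [|k IH].
  apply: ot_ge_bottom => c; have [i [j ->]] := keyP c; rewrite wo_leNlt.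
  by apply/negP => /key_lt_inv[|[]].
have [s_gt s_min] := omega_code_succ.
have [row rowP] := choice (code_row_exists k).
apply: (@ot_ge_mul _ commuting_prs_mul _ (omega_pow wo_omega) (key k 0) (key k.+1 0)
  row _ g x s_gt s_min x0) IH => //.
- by move=> u; have [? /ltW] := gP u.
- move=> u v _ vk [b [ub uE]]; have [i [j bE]] := keyP b.
  have ik : (i <= k)%N.
    rewrite leqNgt; apply/negP => ki; rewrite (vk b) // in ub.
    by rewrite bE wo_leNlt; apply/negP => /key_lt_inv[|[]] //; rewrite ltnNge ki.
  move: ik; rewrite leq_eqVlt => /predU1P[ik|ik]; last first.
    by left=> c kc; apply: uE; rewrite bE; apply: wo_lt_le_trans kc; apply: key_ltl.
  right; apply/omega_powE; exists j; rewrite !rowP -ik -bE; split=> // j'.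
  by rewrite wo_omega_ltE => jj'; rewrite !rowP uE // bE ik; apply: key_ltr.
- move=> u v _ _ uv; apply/fsfunP => j; rewrite !rowP uv // wo_leNlt.
  by apply/negP => /key_lt_inv[|[]]; rewrite ?ltnn.
Qed.

Lemma omega2_below_cover (u : code omega2) : exists k : nat, below (key k 0) u.
Proof.
have [k kP] := fset_bounded (finsupp u)
  (fun c : omega2 => (c : code (wo_fin 2)) (ord_max : 'I_2)).
exists k => c kc; apply/eqP; rewrite -memNfinsupp; apply: contraTN kc => /kP.
have [i [j ->]] := keyP c; rewrite keyE => ik; rewrite -wo_ltNle.
exact: key_ltl.
Qed.

End Final.

Theorem theorem1p6 :
  has_order_type commuting_prs (fun x y : rat => (y <= x)%R)
    (omega_pow wo_omega)
  \/ has_order_type commuting_prs (fun x y : rat => (y <= x)%R)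
    (omega_pow (omega_pow (wo_fin 2))).
Proof.
have [[f [f_anti _]]|[x [g [Px gP g_anti]]]] :=
  @wo_comparison (omega_pow wo_omega) _ [fsfun] commuting_prs_rwo.
  left; exact: ot_ge_has_order_type f_anti ot_ge_omega omega_below_cover.
(* Here omega^omega embeds strictly above x > 0, and [g] feeds the product construction. *)
right; have [f f_anti] := commuting_prs_antitone.
apply: ot_ge_has_order_type f_anti _ omega2_below_cover => k.
exact: ot_ge_omega2 (commuting_prs_gt0 Px) gP g_anti.
Qed.
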